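(* i) Let $\mathcal G$ be a $\Gamma$-periodic graph, $Q$ a $\Gamma$-periodic real potential and $H=\Delta+Q$ the Schrödinger operator on $\mathcal G$. Let $\mathfrak m\in\mathscr F(\kappa)$ be a minimal form on the fundamental graph $G_*=(\mathcal V_*,\mathcal E_* )$, $\nu=\#\mathcal V_*$. Each band $\sigma_n(H)$, $n=1,\ldots,\nu$, satisfies $$\sigma_n(H)\subset[\mu_{\mathfrak m,n},\,\mu_{\mathfrak m,n}+2\varkappa^{\mathfrak m}_+],\qquad \varkappa^{\mathfrak m}_+=\max_{v\in\mathcal V_*}\varkappa^{\mathfrak m}_v,$$ where $\mu_{\mathfrak m,1}\le\ldots\le\mu_{\mathfrak m,\nu}$ are the eigenvalues (counted with multiplicity) of the Schrödinger operator $H^0_{\mathfrak m}=\Delta^0_{\mathfrak m}+Q$ on the graph $G^0_{\mathfrak m}$, and $\varkappa_v^{\mathfrak m}$ is the degree of the vertex $v\in\mathcal V_*$ on the graph $G_{\mathfrak m}$. ii) The Lebesgue measure $|\sigma(H)|$ of the spectrum of $H$ satisfies $$|\sigma(H)|\le\sum_{n=1}^{\nu}|\sigma_n(H)|\le4\mathcal I,$$ where $\mathcal I=\frac12\,\#\operatorname{supp}\mathfrak m$. iii) Let $\mathrm m,\mathrm n\in\mathbb N$ and $\mathrm m\le\mathrm n$. Then there exists a periodic graph $\mathcal G$ such that $\mathcal I=d=\mathrm m$, the Betti number $\beta=\#\mathcal E_*-\#\mathcal V_*+1$ of its fundamental graph equals $\mathrm n$, and the estimate in ii) becomes an identity for any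 ($\Gamma$-periodic) potential $Q$.
   Context: Graphs. Graphs may have loops and multiple edges. Each unoriented edge (including a loop) has two orientations, giving two oriented edges. $(u,v)$ denotes an oriented edge from $u$ to $v$, and $\underline{\mathbf e}$ the inverse of $\mathbf e$. The degree of a vertex is the number of oriented edges starting at it ($\varkappa_v$ on $G_*$). A cycle is a closed path of oriented edges; the cycle space $\mathcal C$ of a finite connected graph is generated by its cycles (first homology group with integer coefficients). Periodic graphs. $\Gamma\subset\mathbb R^d$ is a lattice of rank $d$ with basis $\mathbb A=\{a_1,\ldots,a_d\}$. A $\Gamma$-periodic graph $\mathcal G=(\mathcal V,\mathcal E)$ is a connected infinite locally finite graph embedded in $\mathbb R^d$ (vertices are distinct points) with $\mathcal G+a=\mathcal G$ for all $a\in\Gamma$ and with finite quotient $G_*=\mathcal G/\Gamma=(\mathcal V_*,\mathcal E_* )$, called the fundamental graph; $\mathcal A$ and $\mathcal A_*=\mathcal A/\Gamma$ are the sets of oriented edges of $\mathcal G$ and $G_*$. For $x=\sum_st_sa_s$ put $x_{\mathbb A}=(t_1,\ldots,t_d)$. The coordinate form $\kappa:\mathcal A_*\to\mathbb R^d$ is $\kappa(\mathbf e_* )=v_{\mathbb A}-u_{\mathbb A}$ for any $\mathbf e=(u,v)\in\mathcal A$ in the class $\mathbf e_*$. Forms. A 1-form on $G_*$ is a map $\mathfrak b:\mathcal A_*\to\mathbb R^d$ with $\mathfrak b(\underline{\mathbf e})=-\mathfrak b(\mathbf e)$; its flux function is $\Phi_{\mathfrak b}(\mathbf c)=\sum_{\mathbf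 e\in\mathbf c}\mathfrak b(\mathbf e)$, $\mathbf c\in\mathcal C$. $\mathscr F(\kappa)$ is the set of all 1-forms $\mathfrak b$ on $G_*$ with $\Phi_{\mathfrak b}=\Phi_\kappa$. A form $\mathfrak m\in\mathscr F(\kappa)$ is minimal if $\#\operatorname{supp}\mathfrak m\le\#\operatorname{supp}\mathfrak b$ for all $\mathfrak b\in\mathscr F(\kappa)$ (supports are subsets of $\mathcal A_*$). $\mathcal I$ depends only on the $\Gamma$-periodic graph. Subgraphs. Fix an orientation of each unoriented edge of $G_*$ and put $\mathcal E_{\mathfrak m}=\mathcal E_*\cap\operatorname{supp}\mathfrak m$ (the unoriented edges on which $\mathfrak m\ne0$), $G_{\mathfrak m}=(\mathcal V_*,\mathcal E_{\mathfrak m})$, $G^0_{\mathfrak m}=(\mathcal V_*,\mathcal E_*\setminus\mathcal E_{\mathfrak m})$. Operators. On a graph the Laplacian is $(\Delta f)(v)=\sum_{(v,u)}(f(v)-f(u))$, the sum over all oriented edges starting at $v$; $\Delta$ is that on $\mathcal G$ (acting on $\ell^2(\mathcal V)$) and $\Delta^0_{\mathfrak m}$ that on $G^0_{\mathfrak m}$. $(Qf)(v)=Q(v)f(v)$ with $Q$ real and $Q(v+a)=Q(v)$ for $a\in\Gamma$, so $Q$ also acts on functions on $\mathcal V_*$. Bands. $\mathbb T^d=\mathbb R^d/(2\pi\mathbb Z)^d$. For $\vartheta\in\mathbb T^d$ let $H_{\mathfrak m}(\vartheta)=\Delta_{\mathfrak m}(\vartheta)+Q$ on $\ell^2(\mathcal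 V_* )$, $(\Delta_{\mathfrak m}(\vartheta)f)(v)=\varkappa_vf(v)-\sum_{\mathbf e=(v,u)\in\mathcal A_*}e^{i\langle\mathfrak m(\mathbf e),\vartheta\rangle}f(u)$, with eigenvalues $\lambda_1(\vartheta)\le\ldots\le\lambda_\nu(\vartheta)$ counted with multiplicity (independent of the choice of $\mathfrak m$). The $n$-th band is $\sigma_n(H)=\lambda_n(\mathbb T^d)=[\lambda_n^-,\lambda_n^+]$, and $\sigma(H)=\bigcup_{n=1}^\nu\sigma_n(H)$. $|\cdot|$ is Lebesgue measure on $\mathbb R$. *)

(* Defs.v *)
From HB Require Import structures.
From mathcomp Require Import all_boot all_order all_algebra.
From mathcomp Require Import complex.
From mathcomp Require Import all_classical all_reals all_analysis.

Set Implicit Arguments.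
Unset Strict Implicit.
Unset Printing Implicit Defensive.

Import Order.TTheory GRing.Theory Num.Theory.

Local Open Scope classical_set_scope.
Local Open Scope complex_scope.
Local Open Scope ring_scope.

(** * Graphs *)

(* Loops and multiple edges are allowed. [E] is the type of *oriented* edges.
   [orevN] says that each unoriented edge, loops included, has two distinct
   orientations; so a loop contributes 2 to the degree of its vertex. *)
Record graph (V E : Type) := Graph {
  src : E -> V;
  tgt : E -> V;
  orev : E -> E;
  orevK : involutive orev;
  orevN : forall e, orev e <> e;
  src_orev : forall e, src (orev e) = tgt e }.

Section Graphs.
Variables (V E : Type) (g : graph V E).

Fixpoint walk (u : V) (p : seq E) (v : V) : Prop :=
  if p is e :: p' then src g e = u /\ walk (tgt g e) p' v else u = v.

Definition connected_graph : Prop := forall u v, exists p, walk u p v.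

Definition is_cycle (c : seq E) : Prop := exists v, walk v c v.

Lemma tgt_orev e : tgt g (orev g e) = src g e.
Proof. by rewrite -(src_orev g) orevK. Qed.

End Graphs.

Section FiniteGraphs.
Variables (V E : finType) (g : graph V E).

Definition degree (v : V) : nat := #|[set e | src g e == v]%SET|.

Definition uedges : {set {set E}} := [set [set e; orev g e]%SET | e : E]%SET.

Definition betti : int := #|uedges|%:Z - #|V|%:Z + 1.

End FiniteGraphs.

Section Subgraph.
Variables (V E : Type) (g : graph V E) (P : pred E).
Hypothesis PV : forall e, P (orev g e) = P e.

Definition sub_orev (e : {e | P e}) : {e | P e} :=
  exist _ (orev g (sval e)) (etrans (PV (sval e)) (svalP e)).

Lemma sub_orevK : involutive sub_orev.
Proof. by move=> e; apply: val_inj; rewrite /= orevK. Qed.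

Lemma sub_orevN e : sub_orev e <> e.
Proof. by move=> /(congr1 sval)/=; exact: orevN. Qed.

Lemma sub_src_orev e : src g (sval (sub_orev e)) = tgt g (sval e).
Proof. exact: src_orev. Qed.

(* Same vertices, only the edges satisfying [P]. *)
Definition subgraph : graph V {e | P e} :=
  @Graph V {e | P e} (fun e => src g (sval e)) (fun e => tgt g (sval e))
    sub_orev sub_orevK sub_orevN sub_src_orev.

End Subgraph.

(** * Periodic graphs *)

Section Lattice.
Variables (R : realType) (d : nat).

(* The element \sum_s z_s a_s of the lattice, where a_s is row s of [A]. *)
Definition lattice_vec (A : 'M[R]_d) (z : 'rV[int]_d) : 'rV[R]_d :=
  map_mx intr z *m A.

(* The lattice acts through the coordinates of its elements in the basis
   [basis]. Since there may be multiple edges, its action on oriented edges is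
   part of the data; on vertices it is translation of the positions.
   The fundamental graph [fund_graph] is the quotient by this action: the
   projections [projV] and [projE] are surjective, their fibres are the orbits,
   and the graph structure is the induced one. This determines it up to a unique
   isomorphism; finiteness is expressed by [fvertex] and [fedge] being finite
   types. *)
Record periodicGraph := PeriodicGraph {
  basis : 'M[R]_d;
  basis_unit : basis \in unitmx;

  vertex : choiceType;
  oedge : choiceType;
  pgraph :> graph vertex oedge;
  pos : vertex -> 'rV[R]_d;
  pos_inj : injective pos;
  pgraph_infinite : infinite_set [set: vertex];
  pgraph_connected : connected_graph pgraph;
  pgraph_locfin : forall v, finite_set [set e | src pgraph e = v];

  actV : 'rV[int]_d -> vertex -> vertex;
  actE : 'rV[int]_d -> oedge -> oedge;
  pos_actV : forall z v, pos (actV z v) = pos v + lattice_vec basis z;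
  actE0 : forall e, actE 0 e = e;
  actED : forall z w e, actE (z + w) e = actE z (actE w e);
  src_actE : forall z e, src pgraph (actE z e) = actV z (src pgraph e);
  tgt_actE : forall z e, tgt pgraph (actE z e) = actV z (tgt pgraph e);
  orev_actE : forall z e, orev pgraph (actE z e) = actE z (orev pgraph e);

  fvertex : finType;
  fedge : finType;
  fund_graph : graph fvertex fedge;
  projV : vertex -> fvertex;
  projE : oedge -> fedge;
  projV_surj : forall x, exists v, projV v = x;
  projE_surj : forall x, exists e, projE e = x;
  projV_eq : forall u v, projV u = projV v <-> exists z, v = actV z u;
  projE_eq : forall e f, projE e = projE f <-> exists z, f = actE z e;
  src_projE : forall e, src fund_graph (projE e) = projV (src pgraph e);
  tgt_projE : forall e, tgt fund_graph (projE e) = projV (tgt pgraph e);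
  orev_projE : forall e, orev fund_graph (projE e) = projE (orev pgraph e) }.

End Lattice.

(** * Forms on the fundamental graph *)

Section Forms.
Variables (R : realType) (d : nat) (G : periodicGraph R d).

Record oneForm := OneForm {
  form_fun :> fedge G -> 'rV[R]_d;
  form_odd : forall e, form_fun (orev (fund_graph G) e) = - form_fun e }.

Definition reprV (x : fvertex G) : vertex G := sval (cid (projV_surj x)).
Definition reprE (x : fedge G) : oedge G := sval (cid (projE_surj x)).

Definition coords (x : 'rV[R]_d) : 'rV[R]_d := x *m invmx (basis G).

Definition edge_coords (e : oedge G) : 'rV[R]_d :=
  coords (pos (tgt G e)) - coords (pos (src G e)).

Lemma edge_coords_proj e f : projE e = projE f -> edge_coords e = edge_coords f.
Proof.
move=> /projE_eq[z ->]; rewrite /edge_coords src_actE tgt_actE !pos_actV.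
by rewrite /coords !mulmxDl opprD addrACA subrr addr0.
Qed.

Definition kappa_fun (x : fedge G) : 'rV[R]_d := edge_coords (reprE x).

Lemma kappa_funE e : kappa_fun (projE e) = edge_coords e.
Proof.
by apply: edge_coords_proj; rewrite /reprE; case: cid.
Qed.

Lemma kappa_odd x : kappa_fun (orev (fund_graph G) x) = - kappa_fun x.
Proof.
have [e <-] := projE_surj x.
rewrite orev_projE !kappa_funE /edge_coords src_orev tgt_orev.
by rewrite opprB.
Qed.

Definition kappa : oneForm := OneForm kappa_odd.

(* As [fund_graph G] is connected, each element of its cycle space (its first
   homology with integer coefficients) is the class of a closed path, so a flux
   function is determined by its values on closed paths. *)
Definition flux (b : oneForm) (c : seq (fedge G)) : 'rV[R]_d :=
  \sum_(e <- c) b e.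

Definition in_F_kappa (b : oneForm) : Prop :=
  forall c, is_cycle (fund_graph G) c -> flux b c = flux kappa c.

Definition supp (b : oneForm) : {set fedge G} := [set e | b e != 0]%SET.

Definition minimal_form (m : oneForm) : Prop :=
  in_F_kappa m /\ forall b, in_F_kappa b -> (#|supp m| <= #|supp b|)%N.

(* The number \mathcal I of the periodic graph, for a minimal form [m]. *)
Definition calI (m : oneForm) : R := #|supp m|%:R / 2.

Lemma supp_orev (m : oneForm) e : (m (orev (fund_graph G) e) != 0) = (m e != 0).
Proof. by rewrite form_odd oppr_eq0. Qed.

Lemma suppC_orev (m : oneForm) e : (m (orev (fund_graph G) e) == 0) = (m e == 0).
Proof. by rewrite form_odd oppr_eq0. Qed.

Definition graph_m (m : oneForm) : graph (fvertex G) {e | m e != 0} :=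
  subgraph (supp_orev m).

Definition graph0_m (m : oneForm) : graph (fvertex G) {e | m e == 0} :=
  subgraph (suppC_orev m).

Definition kappa_plus (m : oneForm) : nat :=
  (\max_(v : fvertex G) degree (graph_m m) v)%N.

End Forms.

(** * Operators *)

Section Laplacian.
Variables (R : realType) (V E : choiceType) (g : graph V E).

Definition laplacian (f : V -> R[i]) (v : V) : R[i] :=
  \sum_(e \in [set e | src g e = v]) (f v - f (tgt g e)).

Definition schrodinger (Q : V -> R) (f : V -> R[i]) (v : V) : R[i] :=
  laplacian f v + (Q v)%:C * f v.

End Laplacian.

Section Spectrum.
Variables (R : realType) (V : choiceType).

Definition l2norm_sq (f : V -> R[i]) : \bar R :=
  \esum_(v in [set: V]) (Normc.normc (f v) ^+ 2)%:E.

Definition in_l2 (f : V -> R[i]) : Prop := (l2norm_sq f < +oo)%E.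

(* [z] is in the resolvent set of the bounded operator [T] on l^2(V) if [T - z]
   has a bounded two-sided inverse [S] on l^2(V). *)
Definition resolvent_set (T : (V -> R[i]) -> (V -> R[i])) : set R[i] :=
  [set z | exists (S : (V -> R[i]) -> (V -> R[i])) (M : R),
    forall f, in_l2 f ->
      [/\ (l2norm_sq (S f) <= M%:E * l2norm_sq f)%E,
          (fun v => T (S f) v - z * S f v) = f &
          S (fun v => T f v - z * f v) = f]].

Definition spectrum (T : (V -> R[i]) -> (V -> R[i])) : set R[i] :=
  ~` resolvent_set T.

End Spectrum.

Section Eigenvalues.
Variables (R : realType) (V : finType).

Definition op_mx (T : (V -> R[i]) -> (V -> R[i])) : 'M[R[i]]_#|V| :=
  \matrix_(i, j) T (fun v => (v == enum_val j)%:R) (enum_val i).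

(* The nondecreasing sequence of eigenvalues, counted with multiplicity, of a
   self-adjoint operator on the functions on [V]: the roots of its
   characteristic polynomial. They are real, so taking [Re] only changes their
   type. *)
Definition eigenvalues (T : (V -> R[i]) -> (V -> R[i])) : seq R :=
  sort <=%R [seq complex.Re z |
    z <- sval (closed_field_poly_normal (char_poly (op_mx T)))].

End Eigenvalues.

Section Bands.
Variables (R : realType) (d : nat) (G : periodicGraph R d).

Definition periodic_potential (Q : vertex G -> R) : Prop :=
  forall z v, Q (actV z v) = Q v.

Definition descend (Q : vertex G -> R) (x : fvertex G) : R := Q (reprV x).

(* The part of the spectrum of H on the real line; H is self-adjoint, so this is
   all of its spectrum. *)
Definition sigma (Q : vertex G -> R) : set R :=
  [set x | spectrum (schrodinger G Q) x%:C].

Variables (Q : vertex G -> R) (m : oneForm G).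

Definition inner (x y : 'rV[R]_d) : R := \sum_s x 0 s * y 0 s.

Definition cexpi (t : R) : R[i] := cos t +i* sin t.

Definition fiber_op (theta : 'rV[R]_d) (f : fvertex G -> R[i])
    (v : fvertex G) : R[i] :=
  (degree (fund_graph G) v)%:R * f v
  - \sum_(e | src (fund_graph G) e == v)
      cexpi (inner (m e) theta) * f (tgt (fund_graph G) e)
  + (descend Q v)%:C * f v.

(* Indices start from 0: [lambda n] is the eigenvalue number n + 1. *)
Definition lambda (n : nat) (theta : 'rV[R]_d) : R :=
  nth 0 (eigenvalues (fiber_op theta)) n.

(* The eigenvalues are 2 pi Z^d-periodic in [theta], even though the matrix of
   [fiber_op theta] need not be when [m] is not integer-valued. So the image of
   the torus is the image of R^d. *)
Definition band (n : nat) : set R := range (lambda n).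

Definition mu (n : nat) : R :=
  nth 0 (eigenvalues (schrodinger (graph0_m m) (descend Q))) n.

End Bands.

(* Main.v *)
Require Import Defs.
From mathcomp Require Import all_boot all_order all_algebra.
From mathcomp Require Import perm complex ring lra zify.
From mathcomp Require Import all_classical all_reals all_analysis.

Set Implicit Arguments.
Unset Strict Implicit.
Unset Printing Implicit Defensive.

Import Order.TTheory GRing.Theory Num.Theory.
Import numFieldNormedType.Exports.

Local Open Scope classical_set_scope.
Local Open Scope complex_scope.
Local Open Scope sesquilinear_scope.
Local Open Scope ring_scope.

(** Three arguments carry the theorem.

Bounds on the bands. Outside the support of [m] the phases of the fiber operator
are 1, so its quadratic form differs from that of the operator [H0] on the
subgraph without the support only by a sum over the edges of the support. By the
arithmetic-geometric inequality on each edge, this sum lies between 0 and twice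
the sum of the degrees in the support weighted by the squared moduli
([energy_fiber], [cross_bound]). Let [upper_op] be [H0] plus twice the degree in
the support. By the minimax principle ([eigenvalues_mono]) every band lies between
the eigenvalues of [H0] and of [upper_op] of the same rank. Bounding the degrees by
their maximum gives the enclosure of each band ([band_subset]). The lengths of the
finer enclosures add up to the difference of the traces, which is twice the number
of oriented edges of the support: this bounds the total length of the bands
([sum_measure_bands_le]).

Spectrum in the bands. If [x] is in no band, the eigenvalues of the fibers stay at
a positive distance from [x], uniformly on the cube of quasimomenta, because they
are continuous ([bands_at_distance]). With [B] = H - [x] and a small number [t], the
operator [K] = 1 - t B^2 is then a contraction on each fiber, hence on the functions
of finite support by the Plancherel formula, hence on all square-summable functions,
since the value of [K f] at a vertex depends on finitely many values of [f]
([bound_l2]). A contraction makes the geometric series of [K] converge, which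
inverts B^2, and shows that [B] has no kernel ([bounded_inverse]); so [x] is in the
resolvent set ([sigma_subset_bands]). The Floquet transform of a function of finite
support is a trigonometric polynomial, for which the Plancherel formula already
holds for averages over the points 2 pi k / N with N large ([plancherel]), by the
orthogonality of the characters of a finite cyclic group. The Floquet transform
must produce the phases of [m] and not those of the coordinate form; it uses
positions of the vertices corrected by a potential of the difference of the two
forms, which has zero flux ([gauge_position]).

Sharpness. Take one vertex with [n] loops, the first [k] of which lift to steps in
the coordinate directions of Z^k and the others to loops. The coordinate form is the
only form with its flux, and a truncated plane wave is an approximate eigenfunction
for each energy between q and q + 4 k, so the spectrum has measure at
least 4 k ([bouquet_segment_in_sigma]). This is also the upper bound for the total
length of the bands, so the inequalities between the measure of the spectrum, the
total length of the bands and the upper bound are all equalities. *)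

(** * Squared moduli of complex numbers *)

Section ComplexNumbers.
Variable R : realType.
Implicit Types z w : R[i].

Definition nsq z : R := complex.Re z ^+ 2 + complex.Im z ^+ 2.

Lemma nsqE z : (nsq z)%:C = z * z^*.
Proof. by rewrite /nsq add_Re2_Im2 sqr_normc. Qed.

Lemma nsq_normc z : Normc.normc z ^+ 2 = nsq z.
Proof. by case: z => a b; rewrite /nsq /= sqr_sqrtr// addr_ge0 ?sqr_ge0. Qed.

Lemma nsq_ge0 z : 0 <= nsq z.
Proof. by rewrite addr_ge0 ?sqr_ge0. Qed.

Lemma nsq0 : nsq 0 = 0.
Proof. by rewrite /nsq /= expr0n addr0. Qed.

Lemma nsq_eq0 z : (nsq z == 0) = (z == 0).
Proof. by rewrite paddr_eq0 ?sqr_ge0// !sqrf_eq0 eq_complex. Qed.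

Lemma nsqM z w : nsq (z * w) = nsq z * nsq w.
Proof. by case: z => a b; case: w => c d; rewrite /nsq /=; ring. Qed.

Lemma nsqN z : nsq (- z) = nsq z.
Proof. by case: z => a b; rewrite /nsq /=; ring. Qed.

Lemma nsqC (x : R) : nsq x%:C = x ^+ 2.
Proof. by rewrite /nsq /=; ring. Qed.

Lemma ReD z w : complex.Re (z + w) = complex.Re z + complex.Re w.
Proof. by case: z => a b; case: w. Qed.

Lemma Re_sum I (r : seq I) (P : pred I) (F : I -> R[i]) :
  complex.Re (\sum_(i <- r | P i) F i) = \sum_(i <- r | P i) complex.Re (F i).
Proof. by elim/big_rec2: _ => // i x y _ <-; rewrite ReD. Qed.

Lemma real_complex_sum I (r : seq I) (P : pred I) (F : I -> R) :
  (\sum_(i <- r | P i) F i)%:C = \sum_(i <- r | P i) (F i)%:C :> R[i].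
Proof. exact: rmorph_sum. Qed.

End ComplexNumbers.

(** * Self-adjoint operators on the functions on a finite set *)

Section Spectral.
Variables (R : realType) (V : finType).
Local Notation C := (R[i]).
Local Notation delta w := (fun v : V => (v == w)%:R : C).
Implicit Types (T : (V -> C) -> (V -> C)) (f : V -> C).

Definition selfadjoint T :=
  (forall f v, T f v = \sum_w T (delta w) v * f w) /\
  (forall v w, T (delta w) v = (T (delta v) w)^*).

Definition norm2 f : R := \sum_v nsq (f v).

Definition energy T f : R := \sum_v complex.Re ((f v)^* * T f v).

Definition pairing (p : V -> C) f : C := \sum_v p v * f v.

Lemma sum_enum_val (W : nmodType) (F : V -> W) :
  \sum_v F v = \sum_(i < #|V|) F (enum_val i).
Proof.
rewrite (reindex_onto enum_val enum_rank)/=; last by move=> i _; rewrite enum_rankK.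
by apply: eq_bigl => i; rewrite enum_valK eqxx.
Qed.

(** The eigenvalues are sorted roots of the characteristic polynomial, while the
diagonalisation lists them in an arbitrary order: hence the permutation. *)
Lemma op_mx_diag T : selfadjoint T ->
  exists (P : 'M[C]_#|V|) (d : 'I_#|V| -> R),
   [/\ P \is unitarymx,
       P *m op_mx T = diag_mx (\row_i (d i)%:C) *m P &
       perm_eq (eigenvalues T) (codom d) /\
       \sum_i d i = \sum_v complex.Re (T (delta v) v)].
Proof.
move=> [Tlin Tsym]; set A := op_mx T.
have Aherm : A \is hermsymmx.
  apply/is_hermitianmxP; rewrite expr0 scale1r; apply/matrixP => i j.
  by rewrite !mxE Tsym.
have Anormal := hermitian_normalmx Aherm.
have /mxOverP dreal := hermitian_spectral_diag_real Aherm.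
have /orthomx_spectralP AE := Anormal.
set P := spectralmx A in AE; set D := spectral_diag A in AE dreal.
have Pu : P \is unitarymx by exact: spectral_unitarymx.
have Punit := unitarymx_unit Pu.
pose d i := complex.Re (D 0 i).
have dE i : (d i)%:C = D 0 i by rewrite RRe_real ?dreal.
have DE : \row_i (d i)%:C = D by apply/rowP => i; rewrite mxE dE.
exists P, d; split => //.
  by rewrite DE AE !mulmxA mulmxV// mul1mx.
have charA : char_poly A = \prod_i ('X - (d i)%:C%:P).
  transitivity (char_poly (diag_mx D)).
    rewrite AE /char_poly /char_poly_mx.
    have XE : 'X%:M = map_mx polyC (invmx P) *m 'X%:M *m map_mx polyC P.
      by rewrite mul_mx_scalar -scalemxAl -map_mxM mulVmx// map_mx1 scalemx1.
    rewrite {1}XE !map_mxM/= -mulmxBl -mulmxBr !det_mulmx mulrAC -det_mulmx.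
    by rewrite -map_mxM/= mulVmx// map_mx1 det1 mul1r.
  rewrite char_poly_trig ?diag_mx_is_trig//.
  by apply: eq_bigr => i _; rewrite mxE eqxx mulr1n dE.
split.
  rewrite /eigenvalues perm_sort.
  case: closed_field_poly_normal => r /= rE.
  have : perm_eq r (codom (fun i => (d i)%:C)).
    apply: prod_XsubC_eq; rewrite big_map enumT.
    rewrite -charA rE.
    by rewrite (monicP (char_poly_monic _)) scale1r.
  move=> /(perm_map (@complex.Re R)) /perm_trans; apply.
  by rewrite /codom -map_comp.
have : \tr A = \sum_i (d i)%:C.
  rewrite AE mxtrace_mulC mulmxA mulmxV// mul1mx mxtrace_diag.
  by apply: eq_bigr => i _; rewrite dE.
rewrite -real_complex_sum => /(congr1 (@complex.Re R)) /= <-.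
rewrite /mxtrace Re_sum sum_enum_val.
by apply: eq_bigr => i _; rewrite mxE.
Qed.

Lemma norm2_ge0 f : 0 <= norm2 f.
Proof. by apply: sumr_ge0 => v _; exact: nsq_ge0. Qed.

Lemma size_eigenvalues T : selfadjoint T -> size (eigenvalues T) = #|V|.
Proof.
move=> /op_mx_diag[P [d [_ _ [/perm_size -> _]]]].
by rewrite size_codom card_ord.
Qed.

Lemma sum_eigenvalues T : selfadjoint T ->
  \sum_(i < #|V|) nth 0 (eigenvalues T) i = \sum_v complex.Re (T (delta v) v).
Proof.
move=> Tsa; have [P [d [_ _ [dT <-]]]] := op_mx_diag Tsa.
transitivity (\sum_(x <- eigenvalues T) x).
  by rewrite (big_nth 0) size_eigenvalues// big_mkord.
by rewrite (perm_big _ dT) /codom big_map enumT.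
Qed.

Lemma eigenvalues_le T i j : selfadjoint T -> (i <= j < #|V|)%N ->
  nth 0 (eigenvalues T) i <= nth 0 (eigenvalues T) j.
Proof.
move=> Tsa /andP[ij jn].
apply: (sorted_leq_nth le_trans lexx) => //.
- by apply: sort_sorted; exact: le_total.
- by rewrite inE size_eigenvalues// (leq_ltn_trans ij).
- by rewrite inE size_eigenvalues.
Qed.

Lemma unitary_norm (n : nat) (P : 'M[C]_n) (w : 'cV[C]_n) : P \is unitarymx ->
  \sum_i nsq ((P *m w) i 0) = \sum_i nsq (w i 0).
Proof.
move=> Pu.
have normE (y : 'cV[C]_n) : (\sum_i nsq (y i 0))%:C = (y^t* *m y) 0 0.
  rewrite real_complex_sum mxE; apply: eq_bigr => i _.
  by rewrite nsqE !mxE mulrC.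
apply: (@complexI R); rewrite !normE trmx_mul map_mxM/=.
rewrite -[_ *m (P *m w)]mulmxA (mulmxA (P^t*)).
have -> : P^t* *m P = 1%:M.
  by have := trmxC_unitary P; rewrite Pu => /unitarymxP; rewrite trmxCK.
by rewrite mul1mx.
Qed.

(** The functionals [pairing (p i)] are the coordinates in an orthonormal eigenbasis,
permuted so that their order is that of the sorted eigenvalues. *)
Lemma spectral_theorem T : selfadjoint T ->
  exists p : 'I_#|V| -> V -> C,
   [/\ forall f, \sum_i nsq (pairing (p i) f) = norm2 f,
       forall f i, pairing (p i) (T f) =
                     (nth 0 (eigenvalues T) i)%:C * pairing (p i) f &
       forall f, energy T f =
         \sum_(i < #|V|) nth 0 (eigenvalues T) i * nsq (pairing (p i) f)].
Proof.
move=> Tsa; have [P [d [Pu PT [dT _]]]] := op_mx_diag Tsa.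
have [Tlin _] := Tsa.
have [s sE] : exists s : {perm 'I_#|V|}, forall i, d (s i) = nth 0 (eigenvalues T) i.
  have dE : codom d = [tuple d i | i < #|V|] :> seq R.
    by rewrite /= enumT /codom /image_mem enumT.
  move: dT; rewrite dE => /tuple_permP[s sE].
  exists s => i; rewrite sE (nth_map i) ?size_enum_ord//.
  by rewrite nth_ord_enum tnth_mktuple.
pose col f : 'cV[C]_#|V| := \col_i f (enum_val i).
have colT f : col (T f) = op_mx T *m col f.
  apply/colP => i; rewrite !mxE Tlin sum_enum_val.
  by apply: eq_bigr => j _; rewrite !mxE.
pose p i v := P (s i) (enum_rank v).
have pE i f : pairing (p i) f = (P *m col f) (s i) 0.
  rewrite /pairing sum_enum_val !mxE; apply: eq_bigr => j _.
  by rewrite !mxE /p enum_valK.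
have pT f i : pairing (p i) (T f) = (nth 0 (eigenvalues T) i)%:C * pairing (p i) f.
  rewrite !pE colT mulmxA PT -mulmxA mul_diag_mx mxE -sE.
  by rewrite !mxE.
have reidx (F : 'I_#|V| -> R) : \sum_i F (s i) = \sum_i F i.
  by rewrite [RHS](reindex_inj (@perm_inj _ s)).
exists p; split => // f.
- under eq_bigr do rewrite pE.
  rewrite (reidx (fun j => nsq ((P *m col f) j 0))) unitary_norm//.
  by rewrite /norm2 sum_enum_val; apply: eq_bigr => i _; rewrite mxE.
- have -> : energy T f = complex.Re (((col f)^t* *m col (T f)) 0 0).
    rewrite /energy mxE Re_sum sum_enum_val; apply: eq_bigr => i _.
    by rewrite !mxE.
  have PP : P^t* *m P = 1%:M.
    by have := trmxC_unitary P; rewrite Pu => /unitarymxP; rewrite trmxCK.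
  have -> : (col f)^t* *m col (T f) = (P *m col f)^t* *m (P *m col (T f)).
    by rewrite trmx_mul map_mxM -!mulmxA (mulmxA (P^t*)) PP mul1mx.
  rewrite colT (mulmxA P) PT -mulmxA mul_diag_mx.
  rewrite mxE Re_sum -(reidx (fun i => complex.Re _)).
  apply: eq_bigr => i _; rewrite !pE -sE.
  rewrite [_^t* _ _]mxE [_^T _ _]mxE !mxE.
  set z := (X in nsq X).
  rewrite -/z mulrCA [X in _ * X]mulrC -nsqE -rmorphM.
  by [].
Qed.

(** One condition fewer than the dimension: the square system in which condition [k]
is replaced by 0 = 0 has a zero column. *)
Lemma exists_test_vector (p : 'I_#|V| -> V -> C) (k : 'I_#|V|) :
  exists2 f : V -> C, 0 < norm2 f & forall i, i != k -> pairing (p i) f = 0.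
Proof.
pose M : 'M[C]_#|V| := \matrix_(i, j) if j == k then 0 else p j (enum_val i).
have /det0P[v v0 vM] : \det M == 0.
  rewrite (expand_det_col _ k) big1// => i _.
  by rewrite mxE eqxx mul0r.
exists (fun x => v 0 (enum_rank x)).
  rewrite lt_def norm2_ge0 andbT; apply: contra v0 => /eqP n0.
  apply/eqP/rowP => i; rewrite mxE; apply/eqP; rewrite -nsq_eq0.
  have /psumr_eq0P := n0 => /(_ (fun x _ => nsq_ge0 _)) /(_ (enum_val i) isT).
  by rewrite enum_valK => ->.
move=> i ik; move/rowP/(_ i) : vM; rewrite !mxE => vM.
rewrite -[RHS]vM /pairing sum_enum_val; apply: eq_bigr => j _.
by rewrite mxE (negbTE ik) enum_valK mulrC.
Qed.

(** The Courant-Fischer argument. A nonzero [f] without components along the first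
[k] eigenvectors of [T1] and along the eigenvectors of [T2] after number [k] has its
Rayleigh quotient for [T1] at least at the [k]-th eigenvalue of [T1], and the one
for [T2] at most at the [k]-th eigenvalue of [T2]. The constant [c] makes the lemma
apply to the enclosure of the bands and to the continuity of the eigenvalues. *)
Lemma eigenvalues_mono T1 T2 (c : R) :
  selfadjoint T1 -> selfadjoint T2 ->
  (forall f, energy T1 f <= energy T2 f + c * norm2 f) ->
  forall k, (k < #|V|)%N ->
  nth 0 (eigenvalues T1) k <= nth 0 (eigenvalues T2) k + c.
Proof.
move=> sa1 sa2 le12 k kn.
have [p1 [n1 _ q1]] := spectral_theorem sa1.
have [p2 [n2 _ q2]] := spectral_theorem sa2.
pose k' := Ordinal kn.
pose p (i : 'I_#|V|) := if (i < k)%N then p1 i else p2 i.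
have [f f0 fp] := exists_test_vector p k'.
have f1 (i : 'I_#|V|) : (i < k)%N -> pairing (p1 i) f = 0.
  move=> ik; have := fp i; rewrite /p ik; apply.
  by rewrite -val_eqE/= ltn_eqF.
have f2 (i : 'I_#|V|) : (k < i)%N -> pairing (p2 i) f = 0.
  move=> ik; have := fp i; rewrite /p ltnNge ltnW//=; apply.
  by rewrite -val_eqE/= gtn_eqF.
rewrite -(ler_pM2r f0) mulrDl.
apply: le_trans (le_trans (le12 f) _); last first.
  rewrite lerD2r q2 -n2 mulr_sumr; apply: ler_sum => i _.
  have [ik|ki] := leqP i k; last by rewrite f2// nsq0 !mulr0.
  by rewrite ler_wpM2r ?nsq_ge0// eigenvalues_le// ik.
rewrite q1 -n1 mulr_sumr; apply: ler_sum => i _.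
have [ik|ki] := ltnP i k; first by rewrite f1// nsq0 !mulr0.
by rewrite ler_wpM2r ?nsq_ge0// eigenvalues_le// ki /=.
Qed.

Lemma norm2_intertwine (F G : V -> C) (p : 'I_#|V| -> V -> C) (a : 'I_#|V| -> R) q :
  (forall f, \sum_i nsq (pairing (p i) f) = norm2 f) ->
  (forall i, pairing (p i) G = (a i)%:C * pairing (p i) F) ->
  (forall i, a i ^+ 2 <= q) ->
  norm2 G <= q * norm2 F.
Proof.
move=> n pa aq; rewrite -!n mulr_sumr; apply: ler_sum => i _.
by rewrite pa nsqM nsqC ler_wpM2r ?nsq_ge0.
Qed.

Lemma pairingB p (c : C) f g :
  pairing p (fun v => f v - c * g v) = pairing p f - c * pairing p g.
Proof.
rewrite /pairing mulr_sumr -sumrB; apply: eq_bigr => v _.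
by rewrite mulrBr mulrCA.
Qed.

Definition shift T (x : R) f v : C := T f v - x%:C * f v.

Lemma shift_bound T (x q : R) f : selfadjoint T ->
  (forall i, (i < #|V|)%N -> (nth 0 (eigenvalues T) i - x) ^+ 2 <= q) ->
  norm2 (shift T x f) <= q * norm2 f.
Proof.
move=> /spectral_theorem[p [n1 pT _]] dq.
apply: (@norm2_intertwine _ _ p (fun i => nth 0 (eigenvalues T) i - x)) => //.
  by move=> i; rewrite pairingB pT -mulrBl rmorphB.
by move=> i; exact: dq.
Qed.

(** One step of the iteration used to invert [T] - [x]: it shrinks the component
along each eigenvector whose eigenvalue is away from [x]. *)
Lemma richardson_bound T (x t q : R) f : selfadjoint T ->
  (forall i, (i < #|V|)%N ->
     (1 - t * (nth 0 (eigenvalues T) i - x) ^+ 2) ^+ 2 <= q) ->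
  norm2 (fun v => f v - t%:C * shift T x (shift T x f) v) <= q * norm2 f.
Proof.
move=> /spectral_theorem[p [n1 pT _]] dq.
apply: (@norm2_intertwine _ _ p
  (fun i => 1 - t * (nth 0 (eigenvalues T) i - x) ^+ 2)) => //.
  move=> i; have pS g : pairing (p i) (shift T x g) =
      (nth 0 (eigenvalues T) i - x)%:C * pairing (p i) g.
    by rewrite pairingB pT -mulrBl rmorphB.
  rewrite pairingB !pS; set y := nth 0 _ i - x.
  have -> : (1 - t * y ^+ 2)%:C = 1 - t%:C * y%:C ^+ 2 :> C.
    by rewrite rmorphB rmorphM rmorphXn rmorph1.
  by ring.
by move=> i; exact: dq.
Qed.

End Spectral.

(** * Comparison of the fiber operators with operators without phases *)

Section Cexpi.
Variable R : realType.
Implicit Types s t : R.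

Lemma cexpi0 : cexpi 0 = 1 :> R[i].
Proof. by rewrite /cexpi cos0 sin0. Qed.

Lemma cexpiD s t : cexpi (s + t) = cexpi s * cexpi t.
Proof.
rewrite /cexpi cosD sinD; apply/eqP; rewrite eq_complex /= eqxx /=.
by apply/eqP; ring.
Qed.

Lemma cexpiN t : cexpi (- t) = (cexpi t)^*.
Proof. by rewrite /cexpi cosN sinN. Qed.

Lemma nsq_cexpi t : nsq (cexpi t) = 1.
Proof. by rewrite /nsq /= cos2Dsin2. Qed.

Lemma conj_real_complex (x : R) : (x%:C)^* = x%:C :> R[i].
Proof. exact: conjc_real. Qed.

Lemma Re_conjM_le (a b : R[i]) :
  complex.Re (a^* * b) <= (nsq a + nsq b) / 2.
Proof.
case: a => a1 a2; case: b => b1 b2; rewrite /nsq /=.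
have := sqr_ge0 (a1 - b1); have := sqr_ge0 (a2 - b2); nra.
Qed.

Lemma Re_conjM_ge (a b : R[i]) :
  - ((nsq a + nsq b) / 2) <= complex.Re (a^* * b).
Proof.
by rewrite lerNl -(nsqN b) (le_trans _ (Re_conjM_le _ _))// mulrN raddfN.
Qed.

(** With the modulus of [k] as weight, to measure the effect of a small change [k] of
the phase of an edge. *)
Lemma Re_conjM_weight_le (a b k : R[i]) (s : R) : 0 < s -> nsq k <= s ^+ 2 ->
  complex.Re (a^* * (k * b)) <= s * ((nsq a + nsq b) / 2).
Proof.
move=> s0 ks.
have -> : nsq a + nsq b = (s ^+ 2 * nsq a + s ^+ 2 * nsq b) / s ^+ 2.
  by field; rewrite gt_eqF.
rewrite -(ler_pM2l s0); set y := k * b.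
have yb : nsq y <= s ^+ 2 * nsq b by rewrite nsqM ler_wpM2r ?nsq_ge0.
have -> : s * (s * ((s ^+ 2 * nsq a + s ^+ 2 * nsq b) / s ^+ 2 / 2)) =
    (s ^+ 2 * nsq a + s ^+ 2 * nsq b) / 2.
  by field; rewrite gt_eqF.
have -> : s * complex.Re (a^* * y) = complex.Re ((s%:C * a)^* * y).
  by case: (a) => a1 a2; case: (y) => y1 y2 /=; ring.
by rewrite (le_trans (Re_conjM_le _ _))// nsqM nsqC ler_pM2r ?invr_gt0// lerD2l.
Qed.

Lemma inner0l d (y : 'rV[R]_d) : inner 0 y = 0.
Proof. by rewrite /inner big1// => i _; rewrite mxE mul0r. Qed.

Lemma innerDl d (x y z : 'rV[R]_d) : inner (x + y) z = inner x z + inner y z.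
Proof.
by rewrite /inner -big_split; apply: eq_bigr => i _ /=; rewrite mxE mulrDl.
Qed.

Lemma innerNl d (x z : 'rV[R]_d) : inner (- x) z = - inner x z.
Proof.
by rewrite /inner -sumrN; apply: eq_bigr => i _; rewrite mxE mulNr.
Qed.

End Cexpi.

Section GraphSums.
Variables (V E : finType) (g : graph V E) (W : nmodType).

Lemma sum_src_cond (P : pred E) (F : E -> W) :
  \sum_(e | P e) F e = \sum_v \sum_(e | P e && (src g e == v)) F e.
Proof. exact: partition_big. Qed.

Lemma sum_orev (P : pred E) (F : E -> W) : (forall e, P (orev g e) = P e) ->
  \sum_(e | P e) F (orev g e) = \sum_(e | P e) F e.
Proof.
move=> PV; rewrite [RHS](reindex_inj (inv_inj (orevK g)))/=.
by apply: eq_bigl => e; rewrite PV.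
Qed.

End GraphSums.

Section SelfAdjoint.
Variables (R : realType) (V E : finType) (g : graph V E).
Local Notation C := (R[i]).

(** A common form for the fiber operators ([P] true everywhere, [c] the phases) and
for the operators on the subgraph without the support ([c] = 1). *)
Definition hopping (P : pred E) (a : V -> R) (c : E -> C) (f : V -> C) v : C :=
  (a v)%:C * f v - \sum_(e | P e && (src g e == v)) c e * f (tgt g e).

Variables (P : pred E) (a : V -> R) (c : E -> C).
Hypothesis PV : forall e, P (orev g e) = P e.
Hypothesis cV : forall e, c (orev g e) = (c e)^*.

Lemma sum_delta (v : V) (f : V -> C) : \sum_w (v == w)%:R * f w = f v.
Proof.
rewrite (bigD1 v)//= eqxx mul1r big1 ?addr0// => w wv.
by rewrite eq_sym (negbTE wv) mul0r.
Qed.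

Lemma hopping_selfadjoint : selfadjoint (hopping P a c).
Proof.
split=> [f v|v w].
  rewrite /hopping.
  under [RHS]eq_bigr do rewrite mulrBl -mulrA mulr_suml.
  rewrite sumrB -mulr_sumr sum_delta exchange_big/=; congr (_ - _).
  apply: eq_bigr => e _; rewrite -[in LHS](sum_delta _ f) mulr_sumr.
  by apply: eq_bigr => u _; rewrite mulrA.
rewrite /hopping rmorphB rmorphM/= conj_real_complex conjC_nat rmorph_sum/=.
congr (_ - _).
  by have [->|vw] := eqVneq v w; rewrite ?mulr0// eq_sym (negbTE vw) !mulr0.
have sumE x y : \sum_(e | P e && (src g e == x)) c e * (tgt g e == y)%:R =
    \sum_(e | P e) c e * ((src g e == x) && (tgt g e == y))%:R.
  rewrite big_mkcondr; apply: eq_bigr => e _.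
  by case: (src g e == x); rewrite ?mulr0.
rewrite sumE -(sum_orev _ PV).
transitivity (\sum_(e | P e) (c e * ((src g e == w) && (tgt g e == v))%:R)^*).
  apply: eq_bigr => e _.
  by rewrite rmorphM/= conjC_nat cV src_orev tgt_orev andbC.
by rewrite -!rmorph_sum sumE.
Qed.

Lemma hopping_form f : energy (hopping P a c) f =
  \sum_v a v * nsq (f v) -
  \sum_(e | P e) complex.Re ((f (src g e))^* * (c e * f (tgt g e))).
Proof.
rewrite /energy [X in _ = _ - X](sum_src_cond g) -sumrB; apply: eq_bigr => v _.
rewrite /hopping mulrBr raddfB/= mulrCA [_^* * f v]mulrC -nsqE -rmorphM/=.
congr (_ - _); rewrite mulr_sumr Re_sum; apply: eq_bigr => e /andP[_ /eqP <-].
by [].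
Qed.

Lemma sum_degree f :
  \sum_(e | P e) nsq (f (src g e) : C) =
  \sum_v #|[set e | P e && (src g e == v)]%SET|%:R * nsq (f v).
Proof.
rewrite (sum_src_cond g); apply: eq_bigr => v _.
under eq_bigr => e /andP[_ /eqP ->] do [].
rewrite sumr_const mulr_natl; congr (_ *+ _).
by apply: eq_card => e; rewrite !inE.
Qed.

Lemma sum_tgt (f : V -> C) :
  \sum_(e | P e) nsq (f (tgt g e)) = \sum_(e | P e) nsq (f (src g e)).
Proof.
rewrite -(sum_orev (g := g) _ PV).
by apply: eq_bigr => e _; rewrite tgt_orev.
Qed.

Hypothesis c1 : forall e, nsq (c e) = 1.

(** Arithmetic-geometric inequality on each edge; the squared moduli at sources and
at targets have the same sum, by reversal of the edges. *)
Lemma edge_sum_bound (f : V -> C) :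
  `|\sum_(e | P e) complex.Re ((f (src g e))^* * (c e * f (tgt g e)))|
  <= \sum_(e | P e) nsq (f (src g e)).
Proof.
have -> : \sum_(e | P e) nsq (f (src g e)) =
   \sum_(e | P e) (nsq (f (src g e)) + nsq (c e * f (tgt g e))) / 2.
  rewrite -mulr_suml [X in _ = X / _]big_split/=.
  under [X in _ = (_ + X) / _]eq_bigr do rewrite nsqM c1 mul1r.
  by rewrite sum_tgt; field.
rewrite ler_norml -sumrN; apply/andP; split; apply: ler_sum => e _.
  exact: Re_conjM_ge.
exact: Re_conjM_le.
Qed.

End SelfAdjoint.

Lemma fsum_fin (T : finType) (W : nmodType) (D : pred T) (F : T -> W) :
  \sum_(x \in [set x | D x]) F x = \sum_(x | D x) F x.
Proof.
rewrite (fsbigE (enum [pred x | D x])) ?enum_uniq//; last 2 first.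
- by move=> x /=; rewrite mem_enum.
- by move=> x /= Dx; rewrite mem_enum inE Dx.
by rewrite big_enum_cond/=; apply: eq_bigl => x; rewrite !inE/= mem_setE andbb.
Qed.

Section SubgraphSums.
Variables (E : finType) (P : pred E).

Lemma sum_subtype (W : nmodType) (D : pred E) (F : E -> W) :
  \sum_(x : {e | P e} | D (val x)) F (val x) = \sum_(e | P e && D e) F e.
Proof. by rewrite -(big_sub_cond P D F). Qed.

End SubgraphSums.

Section Comparison.
Variables (R : realType) (d : nat) (G : periodicGraph R d).
Variables (Q : vertex G -> R) (m : oneForm G).
Local Notation V := (fvertex G).
Local Notation C := (R[i]).
Local Notation g := (fund_graph G).
Implicit Types (theta : 'rV[R]_d) (f : V -> C).

Definition phase theta e : C := cexpi (inner (m e) theta).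

Definition degree_on (P : pred (fedge G)) (v : V) : nat :=
  #|[set e | P e && (src g e == v)]%SET|.

Definition H0 := schrodinger (graph0_m m) (descend Q).

(** The factor 2 makes the added multiplication operator dominate the contribution of
the edges of the support whatever their phases. *)
Definition upper_op f v : C :=
  H0 f v + (2 * (degree_on (fun e => m e != 0%R) v)%:R)%:C * f v.

Lemma phaseV theta e : phase theta (orev g e) = (phase theta e)^*.
Proof. by rewrite /phase form_odd innerNl cexpiN. Qed.

Lemma degreeE v : degree g v = degree_on xpredT v.
Proof. by apply: eq_card => e; rewrite !inE. Qed.

Lemma degree_subgraph v : degree (graph_m m) v = degree_on (fun e => m e != 0) v.
Proof.
rewrite /degree /degree_on -!sum1_card.
under eq_bigl do rewrite inE.
rewrite (sum_subtype _ (fun e => src g e == v) (fun=> 1%N)).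
by apply: eq_bigl => e; rewrite inE.
Qed.

Lemma sum_degree_supp :
  (\sum_v degree_on (fun e => m e != 0%R) v)%N = #|supp m|.
Proof.
rewrite -[RHS]sum1_card (sum_src_cond g) /degree_on.
apply: eq_bigr => v _; rewrite -sum1_card.
by apply: eq_bigl => e; rewrite !inE.
Qed.

Lemma fiber_opE theta : fiber_op Q m theta =
  hopping g xpredT (fun v => (degree g v)%:R + descend Q v) (phase theta).
Proof.
apply/funext => f; apply/funext => v; rewrite /fiber_op /hopping rmorphD/=.
by rewrite rmorph_nat/= mulrDl addrAC.
Qed.

Lemma H0E :  H0 = hopping g (fun e => m e == 0)
  (fun v => (degree_on (fun e => m e == 0%R) v)%:R + descend Q v) (fun=> 1).
Proof.
apply/funext => f; apply/funext => v; rewrite /H0 /schrodinger /hopping.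
have -> : laplacian (graph0_m m) f v =
   \sum_(e | (m e == 0) && (src g e == v)) (f v - f (tgt g e)).
  rewrite /laplacian.
  have -> : [set e | src (graph0_m m) e = v] =
      [set e | src (graph0_m m) e == v].
    by apply/seteqP; split => e /eqP.
  rewrite fsum_fin.
  by rewrite (sum_subtype _ (fun e => src g e == v) (fun e => f v - f (tgt g e))).
rewrite sumrB rmorphD/= mulrDl addrAC; congr (_ + _ - _).
  rewrite sumr_const rmorph_nat mulr_natl; congr (_ *+ _).
  by apply: eq_card => e; rewrite !inE.
by apply: eq_bigr => e _; rewrite mul1r.
Qed.

Lemma upper_opE : upper_op = hopping g (fun e => m e == 0)
  (fun v => (degree_on (fun e => m e == 0%R) v)%:R + descend Q v +
            2 * (degree_on (fun e => m e != 0%R) v)%:R) (fun=> 1).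
Proof.
apply/funext => f; apply/funext => v; rewrite /upper_op H0E /hopping.
by rewrite addrAC -mulrDl -rmorphD.
Qed.

Lemma fiber_selfadjoint theta : selfadjoint (fiber_op Q m theta).
Proof. by rewrite fiber_opE; apply: hopping_selfadjoint => // e; exact: phaseV. Qed.

Lemma H0_selfadjoint : selfadjoint H0.
Proof.
rewrite H0E; apply: hopping_selfadjoint => e; first by rewrite form_odd oppr_eq0.
by rewrite conjC1.
Qed.

Lemma upper_selfadjoint : selfadjoint upper_op.
Proof.
rewrite upper_opE; apply: hopping_selfadjoint => e.
  by rewrite form_odd oppr_eq0.
by rewrite conjC1.
Qed.

Definition cross (P : pred (fedge G)) theta f : R :=
  \sum_(e | P e) complex.Re ((f (src g e))^* * (phase theta e * f (tgt g e))).

(** On the edges outside the support of [m] the phase is 1, and these edges contribute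
the same to both operators. *)
Lemma energy_fiber theta f : energy (fiber_op Q m theta) f = energy H0 f +
  (\sum_(e | m e != 0) nsq (f (src g e)) - cross (fun e => m e != 0) theta f).
Proof.
rewrite fiber_opE H0E !hopping_form.
under eq_bigr do rewrite mulrDl degreeE.
under [X in _ = (X - _) + _]eq_bigr do rewrite mulrDl.
rewrite [X in X - _ = _]big_split [X in _ = X - _ + _]big_split/= -!sum_degree.
rewrite [X in X + _ - _ = _](bigID (fun e => m e == 0))/=.
rewrite [X in _ - X = _](bigID (fun e => m e == 0))/=.
rewrite [X in _ - (X + _) = _](eq_bigr (fun e =>
   complex.Re ((f (src g e))^* * (1 * f (tgt g e))))); last first.
  by move=> e /eqP me; rewrite /phase me inner0l cexpi0.
by rewrite /cross; ring.
Qed.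

Lemma cross_bound theta f :
  `|cross (fun e => m e != 0) theta f| <= \sum_(e | m e != 0) nsq (f (src g e)).
Proof.
apply: edge_sum_bound => e; first by rewrite form_odd oppr_eq0.
exact: nsq_cexpi.
Qed.

Lemma energy_upper f :
  energy upper_op f = energy H0 f + 2 * \sum_(e | m e != 0) nsq (f (src g e)).
Proof.
rewrite upper_opE H0E !hopping_form.
under eq_bigr do rewrite mulrDl -mulrA.
by rewrite big_split/= -mulr_sumr -sum_degree addrAC.
Qed.

Lemma mu_le_lambda theta k : (k < #|V|)%N -> mu Q m k <= lambda Q m k theta.
Proof.
move=> kn; rewrite /mu /lambda -[X in _ <= X]addr0.
apply: (eigenvalues_mono H0_selfadjoint (fiber_selfadjoint theta)) => // f.
rewrite mul0r addr0 energy_fiber lerDl subr_ge0.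
by have := cross_bound theta f; rewrite ler_norml => /andP[].
Qed.

Lemma lambda_le_upper theta k : (k < #|V|)%N ->
  lambda Q m k theta <= nth 0 (eigenvalues upper_op) k.
Proof.
move=> kn; rewrite /lambda -[X in _ <= X]addr0.
apply: (eigenvalues_mono (fiber_selfadjoint theta) upper_selfadjoint) => // f.
rewrite mul0r addr0 energy_fiber energy_upper lerD2l.
by have := cross_bound theta f; rewrite ler_norml => /andP[]; lra.
Qed.

Lemma upper_le_mu k : (k < #|V|)%N ->
  nth 0 (eigenvalues upper_op) k <= mu Q m k + 2 * (kappa_plus m)%:R.
Proof.
move=> kn; apply: (eigenvalues_mono upper_selfadjoint H0_selfadjoint) => // f.
rewrite energy_upper lerD2l -mulrA ler_pM2l// sum_degree mulr_sumr.
apply: ler_sum => v _; rewrite ler_wpM2r ?nsq_ge0// ler_nat.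
by rewrite -/(degree_on (fun e => m e != 0) v) -degree_subgraph leq_bigmax.
Qed.

(** A difference of traces: the degrees in the support enter by their sum, and not by
their maximum as in [upper_le_mu]. *)
Lemma sum_enclosure_length :
  \sum_(k < #|V|) (nth 0 (eigenvalues upper_op) k - mu Q m k) = 4 * calI m.
Proof.
have sum_mu := sum_eigenvalues H0_selfadjoint.
rewrite sumrB (sum_eigenvalues upper_selfadjoint) [X in _ - X]sum_mu.
rewrite -sumrB /calI -sum_degree_supp natr_sum.
have -> : 4 * ((\sum_v (degree_on (fun e => m e != 0%R) v)%:R) / 2) =
    \sum_v 2 * (degree_on (fun e => m e != 0%R) v)%:R :> R.
  by rewrite -mulr_sumr; field.
apply: eq_bigr => v _; rewrite /upper_op eqxx mulr1 raddfD/=.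
by rewrite addrC addKr.
Qed.

End Comparison.

(** * Dependence on the quasimomentum *)

Section Continuity.
Variables (R : realType) (d : nat) (G : periodicGraph R d).
Variables (Q : vertex G -> R) (m : oneForm G).
Local Notation V := (fvertex G).
Local Notation C := (R[i]).
Local Notation g := (fund_graph G).
Implicit Types (theta : 'rV[R]_d) (f : V -> C).

Lemma energy_fiber_perturb theta theta' (s : R) f : 0 < s ->
  (forall e, nsq (phase m theta' e - phase m theta e) <= s ^+ 2) ->
  energy (fiber_op Q m theta) f <=
  energy (fiber_op Q m theta') f + s * #|fedge G|%:R * norm2 f.
Proof.
move=> s0 close; rewrite !fiber_opE !hopping_form -addrA lerD2l.
rewrite addrC -lerBlDr opprK addrC -sumrB.
have bound : \sum_e s * ((nsq (f (src g e)) + nsq (f (tgt g e))) / 2) <=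
    s * #|fedge G|%:R * norm2 f.
  rewrite -mulr_sumr -mulrA ler_pM2l// -mulr_suml [X in X / 2]big_split/=.
  rewrite (sum_tgt (g := g) (P := xpredT))//.
  have -> (x : R) : (x + x) / 2 = x by field.
  rewrite (sum_degree g xpredT) mulr_sumr; apply: ler_sum => v _.
  by rewrite ler_wpM2r ?nsq_ge0// ler_nat max_card.
apply: le_trans bound; apply: ler_sum => e _.
rewrite -raddfB/= -mulrBr -mulrBl.
exact: Re_conjM_weight_le.
Qed.

Lemma lambda_perturb theta theta' (s : R) k : 0 < s -> (k < #|V|)%N ->
  (forall e, nsq (phase m theta' e - phase m theta e) <= s ^+ 2) ->
  lambda Q m k theta <= lambda Q m k theta' + s * #|fedge G|%:R.
Proof.
move=> s0 kn close.
apply: (eigenvalues_mono (fiber_selfadjoint Q m theta)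
  (fiber_selfadjoint Q m theta')) => // f.
exact: energy_fiber_perturb.
Qed.

Lemma inner_continuous (y : 'rV[R]_d) : continuous (inner y).
Proof.
apply: (@continuous_big R 'I_d +%R 0 xpredT _ 'rV[R]_d _
  (fun s (t : 'rV[R]_d) => y 0 s * t 0 s)) => [|s _ theta].
  by move=> z; apply: cvgD; [exact: cvg_fst | exact: cvg_snd].
by apply: continuousM; [exact: cst_continuous | exact: coord_continuous].
Qed.

Lemma phase_near theta (s : R) e : 0 < s ->
  \forall theta' \near theta, nsq (phase m theta' e - phase m theta e) <= s ^+ 2.
Proof.
move=> s0; pose h (t : 'rV[R]_d) := nsq (phase m t e - phase m theta e).
have hc : h @ theta --> h theta.
  have ic : inner (m e) @ theta --> inner (m e) theta by exact: inner_continuous.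
  have cc : cos (inner (m e) t) @[t --> theta] --> cos (inner (m e) theta).
    exact: (@cvg_comp _ _ _ (inner (m e)) cos _ _ _ ic (@continuous_cos R _)).
  have sc : sin (inner (m e) t) @[t --> theta] --> sin (inner (m e) theta).
    exact: (@cvg_comp _ _ _ (inner (m e)) sin _ _ _ ic (@continuous_sin R _)).
  have sub (u : 'rV[R]_d -> R) : u t @[t --> theta] --> u theta ->
      (u t - u theta) ^+ 2 @[t --> theta] --> (u theta - u theta) ^+ 2.
    move=> uc; have ud : u t - u theta @[t --> theta] --> u theta - u theta.
      exact: (cvgB uc (cvg_cst (u theta))).
    exact: (cvgM ud ud).
  exact: (cvgD (sub _ cc) (sub _ sc)).
have h0 : h theta = 0 by rewrite /h subrr nsq0.
move/cvgrPdist_le : hc => /(_ (s ^+ 2)); rewrite exprn_gt0// => /(_ isT).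
apply: filterS => t; rewrite h0 sub0r normrN ger0_norm//.
exact: nsq_ge0.
Qed.

Lemma lambda_continuous k : (k < #|V|)%N -> continuous (lambda Q m k).
Proof.
move=> kn.
suff lc (theta : 'rV[R]_d) : lambda Q m k t @[t --> theta] --> lambda Q m k theta.
  by move=> theta; exact: lc.
apply: (iffRL (@cvgrPdist_le R R^o _ (nbhs theta) _ _ _)) => e e0.
pose s : R := e / #|fedge G|.+1%:R.
have s0 : 0 < s by rewrite divr_gt0.
have : \forall theta' \near theta, forall e,
    nsq (phase m theta' e - phase m theta e) <= s ^+ 2.
  by apply: (@filter_forall _ _ _ (nbhs theta)) => e'; exact: phase_near.
apply: (@filterS _ (nbhs theta)) => theta' close.
have se : s * #|fedge G|%:R <= e.
  by rewrite /s mulrAC ler_pdivrMr// ler_pM2l// ler_nat.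
have le1 := lambda_perturb s0 kn close.
have le2 : lambda Q m k theta' <= lambda Q m k theta + s * #|fedge G|%:R.
  by apply: lambda_perturb => // e'; rewrite -nsqN opprB.
move: (lambda Q m k theta) (lambda Q m k theta') le1 le2 => a b le1 le2.
by rewrite ler_distlC; apply/andP; split; lra.
Qed.

(** A compact set of quasimomenta that contains the sampling points of the Plancherel
formula. *)
Definition cube : set 'rV[R]_d :=
  [set theta | forall i, `[0, 2 * pi]%classic (theta ord0 i)].

Lemma bands_at_distance (x : R) :
  (forall k theta, (k < #|V|)%N -> lambda Q m k theta != x) ->
  exists2 delta : R, 0 < delta & forall k theta, (k < #|V|)%N -> cube theta ->
    delta <= `|lambda Q m k theta - x|.
Proof.
move=> xout.
have gap1 (k : 'I_#|V|) : exists2 delta : R, 0 < delta & forall theta, cube theta ->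
    delta <= `|lambda Q m k theta - x|.
  have [|||t tc tmin] := @compact_EVT_min _ R
      (fun theta => `|lambda Q m k theta - x|) cube.
  - by exists 0 => i /=; rewrite mxE in_itv/= lexx mulr_ge0 ?pi_ge0.
  - exact: (@rV_compact R d (fun=> `[0, 2 * pi]%classic)
      (fun=> @segment_compact R 0 (2 * pi))).
  - apply: continuous_subspaceT => theta.
    have lc := lambda_continuous (ltn_ord k) (x := theta).
    exact: (cvg_norm (cvgB lc (cvg_cst x))).
  exists `|lambda Q m k t - x|; first by rewrite normr_gt0 subr_eq0 xout.
  by move=> theta thetac; apply: tmin; rewrite inE.
have /choice[delta deltaP] : forall k : 'I_#|V|, exists delta : R, 0 < delta /\
    forall theta, cube theta -> delta <= `|lambda Q m k theta - x|.
  by move=> k; have [delta d0 dP] := gap1 k; exists delta.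
exists (\big[Num.min/1]_k delta k).
  by apply: (big_ind (fun x => 0 < x)) => // [y z y0 z0|k _]; [rewrite lt_min y0 | have [] := deltaP k].
move=> k theta kn thetac.
have [_ /(_ theta thetac)] := deltaP (Ordinal kn).
by apply: le_trans; exact: bigmin_le.
Qed.

End Continuity.

(** * Lifting edges, and a gauge in which the coordinate form becomes [m] *)

Section Potential.
Variables (W : zmodType) (V : Type) (E : eqType) (g : graph V E).

Lemma walk_cat u v w p q : walk g u p v -> walk g v q w -> walk g u (p ++ q) w.
Proof.
elim: p u => [|e p IH] u /=; first by move=> ->.
by move=> [se /IH h] /h.
Qed.

Lemma walk_rev u v p : walk g u p v -> walk g v (rev [seq orev g e | e <- p]) u.
Proof.
elim: p u => [|e p IH] u /=; first by move=> ->.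
move=> [se /IH h]; rewrite rev_cons -cats1.
by apply: (walk_cat h) => /=; rewrite src_orev tgt_orev.
Qed.

(** The sum of the form along any path from a base point: closing a path to the
source, the edge, and the reverse of a path to the target gives a cycle. *)
Lemma zero_flux_potential (b : E -> W) :
  connected_graph g -> (forall e, b (orev g e) = - b e) ->
  (forall c, is_cycle g c -> \sum_(e <- c) b e = 0) ->
  exists psi : V -> W, forall e, b e = psi (tgt g e) - psi (src g e).
Proof.
move=> conn bodd b0.
have [[x0]|noV] := pselect (inhabited V); last first.
  by exists (fun=> 0) => e; case: noV; constructor; exact: src g e.
have /choice[w wP] := conn x0.
exists (fun x => \sum_(e <- w x) b e) => e.
have := b0 (w (src g e) ++ e :: rev [seq orev g e | e <- w (tgt g e)]).
rewrite big_cat big_cons /= (perm_big _ (permEl (perm_rev _)))/= big_map.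
under [X in _ + (_ + X)]eq_bigr do rewrite bodd.
rewrite sumrN => cyc; apply/eqP.
rewrite -subr_eq0 opprB addrCA; apply/eqP; apply: cyc.
exists x0; apply: walk_cat (wP _) _ => /=; split=> //.
exact: walk_rev.
Qed.

End Potential.

Section Lift.
Variables (R : realType) (d : nat) (G : periodicGraph R d).
Local Notation gr := (fund_graph G).
Local Notation C := (R[i]).
Implicit Types (v : vertex G) (e : fedge G) (x : oedge G) (z : 'rV[int]_d).

Lemma actV_id z v : actV z v = v -> z = 0.
Proof.
move=> /(congr1 (@pos _ _ G)); rewrite pos_actV => /eqP.
rewrite -subr_eq0 addrAC subrr add0r /lattice_vec => /eqP zA.
have : map_mx (intr : int -> R) z = 0.
  by rewrite -(mulmxK (basis_unit G) (map_mx _ z)) zA mul0mx.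
move=> /rowP z0; apply/rowP => i; have := z0 i; rewrite !mxE => /eqP.
by rewrite intr_eq0 => /eqP.
Qed.

Lemma edge_lift_uniq x y : src G x = src G y -> projE x = projE y -> x = y.
Proof.
move=> sxy /projE_eq[z yE]; move: sxy; rewrite yE src_actE => /esym/actV_id ->.
by rewrite actE0.
Qed.

Lemma edge_lift e v : src gr e = projV v -> exists x, src G x = v /\ projE x = e.
Proof.
have [x <-] := projE_surj e; rewrite src_projE => /projV_eq[z ->].
exists (actE z x); rewrite src_actE; split => //.
by apply/esym/projE_eq; exists z.
Qed.

(** The end of the lift of [e] that starts at [v]; the value [v] is used when [v] does
not lie over the source of [e]. *)
Definition neighbour e v : vertex G :=
  if pselect (exists x, src G x = v /\ projE x = e) is left h
  then tgt G (sval (cid h)) else v.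

Lemma neighbourE x : neighbour (projE x) (src G x) = tgt G x.
Proof.
rewrite /neighbour; case: pselect => [h|]; last by case; exists x.
by case: cid => y /= [sy py]; rewrite (edge_lift_uniq sy py).
Qed.

Lemma projV_neighbour e v : src gr e = projV v -> projV (neighbour e v) = tgt gr e.
Proof. by move=> /edge_lift[x [<- <-]]; rewrite neighbourE tgt_projE. Qed.

Lemma neighbourK e v :
  src gr e = projV v -> neighbour (orev gr e) (neighbour e v) = v.
Proof.
move=> /edge_lift[x [<- <-]]; rewrite neighbourE orev_projE -(src_orev G).
by rewrite neighbourE tgt_orev.
Qed.

Lemma edges_bij v : set_bij [set x | src G x = v] [set e | src gr e == projV v]
  (@projE _ _ G).
Proof.
split=> [x /= <-|x y|e /= /eqP /edge_lift[x [sx <-]]].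
- by rewrite src_projE.
- by rewrite !inE => <- sy; apply: edge_lift_uniq.
- by exists x.
Qed.

Lemma schrodingerE (Q : vertex G -> R) (f : vertex G -> C) v :
  schrodinger G Q f v =
  (degree gr (projV v))%:R * f v
  - \sum_(e | src gr e == projV v) f (neighbour e v) + (Q v)%:C * f v.
Proof.
rewrite /schrodinger; congr (_ + _).
transitivity (\sum_(e | src gr e == projV v) (f v - f (neighbour e v))).
  rewrite -fsum_fin (reindex_fsbig _ _ _ _ (edges_bij v)).
  by apply: eq_fsbigr => x; rewrite inE /= => sx; rewrite -sx neighbourE.
rewrite sumrB sumr_const mulr_natl; congr (_ *+ _ - _).
by apply: eq_card => e; rewrite !inE.
Qed.

Lemma fund_connected : connected_graph gr.
Proof.
move=> a b; have [u <-] := projV_surj a; have [v <-] := projV_surj b.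
have [p pP] := pgraph_connected u v.
exists [seq projE x | x <- p].
elim: p u pP => [|x p IH] u /=; first by move=> ->.
by move=> [<- /IH]; rewrite src_projE tgt_projE.
Qed.

Variable m : oneForm G.
Hypothesis mF : in_F_kappa m.

(** The coordinate form is the displacement along an edge in the coordinates of the
embedding. Shifting the vertices of each orbit by a common vector changes the
displacements by a gradient, and [m] differs from the coordinate form by one. *)
Lemma gauge_position : exists P : vertex G -> 'rV[R]_d,
  (forall z v, P (actV z v) = P v + map_mx intr z) /\
  (forall e v, src gr e = projV v -> P (neighbour e v) = P v + m e).
Proof.
have [] := @zero_flux_potential _ _ _ gr (fun e => m e - kappa G e).
- exact: fund_connected.
- by move=> e; rewrite (form_odd m) (form_odd (kappa G)) [RHS]opprD.
- by move=> c cc; apply/eqP; rewrite [X in X == _]sumrB subr_eq0; apply/eqP; exact: mF cc.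
move=> psi psiE; exists (fun v => coords G (pos v) + psi (projV v)); split.
  move=> z v; have -> : projV (actV z v) = projV v.
    by apply/esym/projV_eq; exists z.
  rewrite pos_actV /coords mulmxDl addrAC /lattice_vec mulmxK//.
  exact: basis_unit.
move=> e v sev; rewrite projV_neighbour//.
have [x [sx px]] := edge_lift sev; rewrite -sx -px neighbourE.
have := psiE e; rewrite -px /= kappa_funE /edge_coords.
rewrite -src_projE => /eqP; rewrite subr_eq => /eqP ->.
rewrite px; set a := coords _ _; set b := coords _ _.
by clearbody a b; apply/rowP => i; rewrite !mxE; ring.
Qed.

End Lift.

(** * The Plancherel formula, by sampling *)

Section CharacterSums.
Variable R : realType.
Local Notation C := (R[i]).

Lemma cexpi_sum I (r : seq I) (P : pred I) (t : I -> R) :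
  cexpi (\sum_(i <- r | P i) t i) = \prod_(i <- r | P i) cexpi (t i) :> C.
Proof. by rewrite (big_morph _ (@cexpiD R) (@cexpi0 R)). Qed.

Lemma cexpiMn (t : R) n : cexpi (n%:R * t) = cexpi t ^+ n :> C.
Proof.
elim: n => [|n IH]; first by rewrite mul0r cexpi0 expr0.
by rewrite -natr1 mulrDl mul1r cexpiD IH exprSr.
Qed.

Lemma cexpi_2pi_int (z : int) : cexpi (z%:~R * (2 * pi)) = 1 :> C.
Proof.
have c2pi n : cexpi (n%:R * (2 * pi)) = 1 :> C.
  rewrite cexpiMn; suff -> : cexpi (2 * pi) = 1 :> C by rewrite expr1n.
  by rewrite /cexpi mulr_natl cos2pi sin2pi.
case: z => n; first exact: c2pi.
by rewrite NegzE rmorphN mulNr cexpiN c2pi conjC1.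
Qed.

Lemma cexpi_neq1 (t : R) : 0 < `|t| < 2 * pi -> cexpi t != 1 :> C.
Proof.
move=> /andP[t0 t2]; apply/negP => /eqP [ct _].
have st : 0 < sin (`|t| / 2).
  by apply: sin_gt0_pi; rewrite divr_gt0//= ltr_pdivrMr// mulrC.
have : cos `|t| = 1.
  by have [_|_] := ger0P t; rewrite ?cosN.
have -> : `|t| = `|t| / 2 + `|t| / 2 by field.
rewrite cosD -!expr2 => c1.
have := cos2Dsin2 (`|t| / 2); nra.
Qed.

(** Geometric sum of a root of unity, which differs from 1 because the numerator is
smaller than [N]. *)
Lemma root_of_unity_sum (z : int) (N : nat) : (`|z| < N)%N ->
  \sum_(j < N) cexpi (z%:~R * (2 * pi * j%:R / N%:R)) =
  if z == 0 then N%:R else 0 :> C.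
Proof.
move=> zN; have N0 : (0 < N)%N by apply: leq_ltn_trans zN.
have NR : N%:R != 0 :> R by rewrite pnatr_eq0 -lt0n.
case: eqP => [->|/eqP z0].
  under eq_bigr do rewrite mul0r cexpi0.
  by rewrite sumr_const card_ord.
set w : C := cexpi (z%:~R * (2 * pi / N%:R)).
under eq_bigr => j _.
  rewrite (_ : _ * _ = j%:R * (z%:~R * (2 * pi / N%:R))); last by field.
  rewrite cexpiMn -/w; over.
have wN : w ^+ N = 1.
  rewrite -cexpiMn -(cexpi_2pi_int z); congr cexpi; by field.
have w1 : w - 1 != 0.
  rewrite subr_eq0 cexpi_neq1//.
  have -> : `|z%:~R * (2 * pi / N%:R)| = `|z|%N%:R * (2 * pi / N%:R) :> R.
    rewrite normrM natr_absz intr_norm; congr (_ * _).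
    by rewrite ger0_norm// divr_ge0 ?mulr_ge0 ?pi_ge0.
  apply/andP; split.
    by rewrite mulr_gt0 ?divr_gt0 ?mulr_gt0 ?pi_gt0 ?ltr0n// absz_gt0.
  rewrite mulrA ltr_pdivrMr ?ltr0n// mulrC ltr_pM2l ?ltr_nat//.
  by rewrite mulr_gt0 ?pi_gt0.
apply: (mulfI w1); rewrite mulr0 -subrX1 wN subrr.
by [].
Qed.

Variable d : nat.

Definition sample (N : nat) (k : {ffun 'I_d -> 'I_N}) : 'rV[R]_d :=
  \row_i (2 * pi * (k i)%:R / N%:R).

Lemma sample_cube N k : cube (@sample N k).
Proof.
move=> i /=; rewrite mxE in_itv/=.
have N0 : (0 < N)%N by case: (k i) => j /=; exact: leq_ltn_trans.
rewrite divr_ge0 ?mulr_ge0 ?pi_ge0//= ler_pdivrMr ?ltr0n//.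
by rewrite ler_wpM2l ?mulr_ge0 ?pi_ge0// ler_nat ltnW.
Qed.

Lemma character_sum (N : nat) (z : 'rV[int]_d) : (forall i, (`|z 0%R i| < N)%N) ->
  \sum_(k : {ffun 'I_d -> 'I_N}) cexpi (inner (map_mx intr z) (sample k)) =
  if z == 0 then (N ^ d)%:R else 0 :> C.
Proof.
move=> zN.
under eq_bigr => k _.
  rewrite /inner cexpi_sum; under eq_bigr => i _ do rewrite !mxE; over.
rewrite -(bigA_distr_bigA (fun i (j : 'I_N) =>
  cexpi ((z 0 i)%:~R * (2 * pi * j%:R / N%:R)) : C))/=.
under eq_bigr do rewrite root_of_unity_sum//.
case: eqP => [->|/eqP z0].
  under eq_bigr do rewrite mxE eqxx.
  by rewrite prodr_const card_ord natrX.
have [i zi] : exists i, z 0 i != 0.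
  by have /rV0Pn := z0.
by rewrite (bigD1 i)//= (negbTE zi) mul0r.
Qed.

End CharacterSums.

Section Floquet.
Variables (R : realType) (d : nat) (G : periodicGraph R d) (m : oneForm G).
Local Notation gr := (fund_graph G).
Local Notation C := (R[i]).
Implicit Types (f : vertex G -> C) (s : seq (vertex G)) (theta : 'rV[R]_d).
Implicit Types (v w : vertex G) (x : fvertex G) (e : fedge G).

Variable P : vertex G -> 'rV[R]_d.
Hypothesis P_actV : forall z v, P (actV z v) = P v + map_mx intr z.
Hypothesis P_neighbour : forall e v,
  src gr e = projV v -> P (neighbour e v) = P v + m e.

Definition supported s f := forall v, f v != 0 -> v \in s.

Definition wave theta v : C := cexpi (- inner (P v) theta).

(** The Floquet transform. It is meaningful for functions of finite support, for which
the sum over the fibre is a finite one. *)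
Definition fourier f theta x : C :=
  \sum_(v \in [set v | projV v = x]) f v * wave theta v.

Lemma fourierE s f theta x : uniq s -> supported s f ->
  fourier f theta x = \sum_(v <- s | projV v == x) f v * wave theta v.
Proof.
move=> us sf; rewrite [RHS]bigfs//.
  by apply: eq_fsbigl; apply/seteqP; split => v /eqP.
move=> v _ vs; suff -> : f v = 0 by rewrite mul0r.
by apply/eqP; apply: contraNT vs => /sf.
Qed.

Lemma actV0 v : actV 0 v = v.
Proof.
apply: (@pos_inj _ _ G); rewrite pos_actV /lattice_vec.
by rewrite map_mx0 mul0mx addr0.
Qed.

Lemma same_fibre v w : projV v = projV w ->
  exists z, w = actV z v /\ P w - P v = map_mx intr z.
Proof.
by move=> /projV_eq[z ->]; exists z; rewrite P_actV addrAC subrr add0r.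
Qed.

(** For [N] larger than the coordinates of all the translations between points of the
support, distinct points of a fibre stay distinct modulo [N], and only the diagonal
terms survive in the average over the sampling points. *)
Lemma plancherel s f : uniq s -> supported s f -> exists N0, forall N, (N0 <= N)%N ->
  \sum_(k : {ffun 'I_d -> 'I_N}) norm2 (fourier f (sample R k)) =
  (N ^ d)%:R * \sum_(v <- s) nsq (f v).
Proof.
move=> us sf.
have /choice[z zP] : forall vw : vertex G * vertex G, exists z,
    projV vw.1 = projV vw.2 ->
    vw.2 = actV z vw.1 /\ P vw.2 - P vw.1 = map_mx intr z.
  move=> [v w]; have [vw|vw] := pselect (projV v = projV w); last by exists 0.
  by have [z zP] := same_fibre vw; exists z.
exists (\sum_(v <- s) \sum_(w <- s) \sum_i `|z (v, w) 0%R i|).+1%N => N N0.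
have zN v w : v \in s -> w \in s -> forall i, (`|z (v, w) 0%R i| < N)%N.
  move=> vs ws i; apply: leq_trans N0; rewrite ltnS.
  rewrite (big_rem v)//= (big_rem w)//= (bigD1 i)//= -!addnA.
  exact: leq_addr.
apply: (@complexI R).
have -> (y : R) : ((N ^ d)%:R * y)%:C = (N ^ d)%:R * y%:C :> C.
  by rewrite rmorphM rmorph_nat.
rewrite !real_complex_sum.
pose F (k : {ffun 'I_d -> 'I_N}) v w : C := f v * (f w)^* *
  cexpi (inner (P w - P v) (sample R k)).
transitivity (\sum_(k : {ffun 'I_d -> 'I_N})
    \sum_(v <- s) \sum_(w <- s | projV w == projV v) F k v w).
  apply: eq_bigr => k _; rewrite real_complex_sum.
  rewrite [RHS](partition_big (@projV _ _ G) xpredT)//=.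
  apply: eq_bigr => x _; rewrite nsqE !(fourierE _ _ us sf) rmorph_sum mulr_suml.
  apply: eq_bigr => v /eqP vx; rewrite mulr_sumr vx; apply: eq_bigr => w _.
  rewrite rmorphM mulrACA /F; congr (_ * _).
  transitivity (wave (sample R k) v * cexpi (inner (P w) (sample R k))).
    by congr (_ * _); rewrite -[inner _ _]opprK cexpiN.
  by rewrite /wave -cexpiD innerDl innerNl addrC.
rewrite exchange_big mulr_sumr; apply: eq_big_seq => v vs.
rewrite exchange_big/= (big_rem v)//= eqxx [X in _ + X]big_seq_cond [X in _ + X]big1 ?addr0.
  transitivity (\sum_(k : {ffun 'I_d -> 'I_N}) f v * (f v)^*).
    by apply: eq_bigr => k _; rewrite /F subrr inner0l cexpi0 mulr1.
  by rewrite sumr_const card_ffun !card_ord mulr_natl nsqE.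
move=> w /andP[ws /eqP wv]; rewrite -mulr_sumr.
have wv' : w \in s by exact: mem_rem ws.
have [/= wE PE] := zP (v, w) (esym wv); rewrite PE.
rewrite character_sum; last by move=> i; exact: zN.
have [z0|_] := eqVneq (z (v, w)) 0; last by rewrite mulr0.
by move: ws; rewrite {1}wE z0 actV0 mem_rem_uniq// !inE eqxx.
Qed.

(** Preservation of finite support is part of the notion, so that symbols can be
composed. *)
Definition has_symbol (L : (vertex G -> C) -> vertex G -> C)
    (A : 'rV[R]_d -> (fvertex G -> C) -> fvertex G -> C) :=
  forall s f, supported s f -> exists s', supported s' (L f) /\
    forall theta, fourier (L f) theta = A theta (fourier f theta).

Lemma supported_catl s s' f : supported s f -> supported (s ++ s') f.
Proof. by move=> sf v /sf vs; rewrite mem_cat vs. Qed.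

Lemma supported_catr s s' f : supported s f -> supported (s' ++ s) f.
Proof. by move=> sf v /sf vs; rewrite mem_cat vs orbT. Qed.

Lemma supported_undup s f : supported s f -> supported (undup s) f.
Proof. by move=> sf v /sf vs; rewrite mem_undup. Qed.

Lemma has_symbol_id : has_symbol (fun f => f) (fun _ g => g).
Proof. by move=> s f sf; exists s. Qed.

Lemma has_symbol_comp L1 L2 A1 A2 : has_symbol L1 A1 -> has_symbol L2 A2 ->
  has_symbol (fun f => L1 (L2 f)) (fun theta g => A1 theta (A2 theta g)).
Proof.
move=> h1 h2 s f /h2[s2 [sf2 E2]]; have [s1 [sf1 E1]] := h1 _ _ sf2.
by exists s1; split => // theta; rewrite E1 E2.
Qed.

Lemma has_symbolB (c : C) L1 L2 A1 A2 : has_symbol L1 A1 -> has_symbol L2 A2 ->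
  has_symbol (fun f v => L1 f v - c * L2 f v)
             (fun theta g x => A1 theta g x - c * A2 theta g x).
Proof.
move=> h1 h2 s f sf; have [s1 [sf1 E1]] := h1 _ _ sf.
have [s2 [sf2 E2]] := h2 _ _ sf; pose u := undup (s1 ++ s2).
have uu : uniq u by exact: undup_uniq.
have u1 : supported u (L1 f) by apply/supported_undup/supported_catl.
have u2 : supported u (L2 f) by apply/supported_undup/supported_catr.
have u12 : supported u (fun v => L1 f v - c * L2 f v).
  move=> v; apply: contraNT => vu.
  have /eqP -> : L1 f v == 0 by apply: contraNT vu => /u1.
  have /eqP -> : L2 f v == 0 by apply: contraNT vu => /u2.
  by rewrite mulr0 subr0.
exists u; split => // theta; apply/funext => x.
rewrite -E1 -E2 (fourierE _ _ uu u12) (fourierE _ _ uu u1) (fourierE _ _ uu u2).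
rewrite mulr_sumr -sumrB; apply: eq_bigr => v _.
by rewrite mulrBl mulrA.
Qed.

Lemma wave_neighbour e v theta : src gr e = projV v ->
  wave theta v = phase m theta e * wave theta (neighbour e v).
Proof.
move=> sev; rewrite /wave /phase P_neighbour// -cexpiD; congr cexpi.
by rewrite innerDl opprD [RHS]addrC subrK.
Qed.

Lemma neighbour_bij e : set_bij [set v | projV v = src gr e]
  [set v | projV v = tgt gr e] (neighbour e).
Proof.
split=> [v /= vs|v w|w /= wt].
- by rewrite projV_neighbour.
- rewrite !inE /= => vs ws vw.
  by rewrite -(neighbourK (esym vs)) -(neighbourK (esym ws)) vw.
- have sw : src gr (orev gr e) = projV w by rewrite src_orev wt.
  exists (neighbour (orev gr e) w) => /=.
    by rewrite projV_neighbour// tgt_orev.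
  by rewrite -{1}(orevK gr e) neighbourK.
Qed.

Variable Q : vertex G -> R.
Hypothesis Qper : periodic_potential Q.

Lemma descendE v : descend Q (projV v) = Q v.
Proof.
rewrite /descend /reprV; case: cid => w /= /projV_eq[z ->].
by rewrite Qper.
Qed.

(** Only the hopping term needs an argument: moving along the lifts of [e] permutes
fibres and multiplies the waves by the phase of [m e]. *)
Lemma has_symbol_schrodinger : has_symbol (schrodinger G Q) (fiber_op Q m).
Proof.
move=> s f sf.
(* The support grows at most by the neighbours of its points. *)
pose s' := s ++ [seq neighbour e w | e <- enum (fedge G), w <- s].
pose u := undup s'.
have uu : uniq u by exact: undup_uniq.
have uf : supported u f by apply/supported_undup/supported_catl.
have hop0 v e : v \notin u -> src gr e = projV v -> f (neighbour e v) = 0.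
  move=> vu sev; apply/eqP; apply: contraNT vu => /sf fs.
  rewrite mem_undup mem_cat -(neighbourK sev) orbC.
  by rewrite allpairs_f// mem_enum.
have uH : supported u (schrodinger G Q f).
  move=> v; apply: contraNT => vu; rewrite schrodingerE.
  have /eqP -> : f v == 0 by apply: contraNT vu => /uf.
  rewrite big1 ?mulr0 ?subr0 ?addr0// => e /eqP; exact: hop0.
exists u; split => // theta; apply/funext => x.
rewrite (fourierE _ _ uu uH) /fiber_op (fourierE _ _ uu uf).
have hopE : \sum_(v <- u | projV v == x)
     (\sum_(e | src gr e == x) f (neighbour e v)) * wave theta v =
    \sum_(e | src gr e == x) phase m theta e * fourier f theta (tgt gr e).
  under eq_bigr do rewrite mulr_suml.
  rewrite exchange_big/=; apply: eq_bigr => e /eqP sex.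
  rewrite bigfs//; last first.
    by move=> v /eqP vx vu; rewrite (hop0 _ _ vu) ?mul0r// sex.
  rewrite /fourier mulr_fsumr (reindex_fsbig _ _ _ _ (neighbour_bij e)).
  have -> : [set` (fun v => projV v == x)] = [set v | projV v = src gr e].
    by rewrite sex; apply/seteqP; split => v /eqP.
  apply: eq_fsbigr => v; rewrite inE /= => vs.
  by rewrite (wave_neighbour theta (esym vs)) mulrCA.
rewrite -hopE !mulr_sumr -sumrB -big_split/=; apply: eq_bigr => v /eqP vx.
by rewrite schrodingerE vx -descendE vx !mulrDl mulNr !mulrA.
Qed.

End Floquet.

(** * Square-summable functions and local operators *)

Section SquareSummable.
Variables (R : realType) (V : choiceType).
Local Notation C := (R[i]).
Implicit Types (f : V -> C) (s : seq V) (c : R).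

Definition sqsum_le f c := forall s, uniq s -> \sum_(v <- s) nsq (f v) <= c.

Lemma l2norm_le f c : (l2norm_sq f <= c%:E)%E <-> sqsum_le f c.
Proof.
split=> [fc s us|fc].
  rewrite -lee_fin -sumEFin; apply: le_trans fc; apply: esum_ge.
  exists [set` s]; first by split=> //; exact: finite_seq.
  rewrite -fsbig_seq// le_eqVlt; apply/orP; left; apply/eqP.
  by apply: eq_bigr => v _; rewrite nsq_normc.
apply: ge_ereal_sup => _ [X [finX _] <-].
rewrite fsbig_finite//= sumEFin lee_fin.
under eq_bigr do rewrite nsq_normc.
exact/fc/finmap.fset_uniq.
Qed.

Lemma in_l2P f : in_l2 f <-> exists2 c, 0 <= c & l2norm_sq f = c%:E.
Proof.
have ge0 : (0 <= l2norm_sq f)%E by apply: esum_ge0 => v _; rewrite lee_fin sqr_ge0.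
split=> [fl2|[c _ fc]]; last by rewrite /in_l2 fc ltry.
exists (fine (l2norm_sq f)); first by rewrite fine_ge0.
by rewrite fineK// ge0_fin_numE.
Qed.

(** Locality lets estimates on functions of finite support pass to all functions. *)
Definition local_op (L : (V -> C) -> V -> C) :=
  forall v, exists s, forall f g, {in s, f =1 g} -> L f v = L g v.

Lemma local_id : local_op (fun f => f).
Proof. by move=> v; exists [:: v] => f g; apply; rewrite inE. Qed.

Lemma local_comp L1 L2 : local_op L1 -> local_op L2 ->
  local_op (fun f => L1 (L2 f)).
Proof.
move=> l1 l2 v; have [s sP] := l1 v.
have /choice[n nP] := l2.
exists (flatten [seq n w | w <- s]) => f g fg.
apply: sP => w ws; apply: nP => u uw; apply: fg.
by apply/flattenP; exists (n w) => //; exact: map_f.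
Qed.

Lemma localB (c : C) L1 L2 : local_op L1 -> local_op L2 ->
  local_op (fun f v => L1 f v - c * L2 f v).
Proof.
move=> l1 l2 v; have [s1 P1] := l1 v; have [s2 P2] := l2 v.
exists (s1 ++ s2) => f g fg; rewrite (P1 f g) ?(P2 f g)// => w ws; apply: fg.
  by rewrite mem_cat ws orbT.
by rewrite mem_cat ws.
Qed.

End SquareSummable.

Section FloquetBound.
Variables (R : realType) (d : nat) (G : periodicGraph R d).
Local Notation C := (R[i]).
Variable P : vertex G -> 'rV[R]_d.
Hypothesis P_actV : forall z v, P (actV z v) = P v + map_mx intr z.
Variables (L : (vertex G -> C) -> vertex G -> C).
Variables (A : 'rV[R]_d -> (fvertex G -> C) -> fvertex G -> C) (q : R).
Hypothesis LA : has_symbol P L A.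
Hypothesis q0 : 0 <= q.
Hypothesis Aq : forall theta g, cube theta -> norm2 (A theta g) <= q * norm2 g.

(** Sampling finely enough for both [f] and [L f] turns the norms into averages over
the fibers. *)
Lemma bound_finite s f : uniq s -> supported s f ->
  sqsum_le (L f) (q * \sum_(v <- s) nsq (f v)).
Proof.
move=> us sf s' us'; have [t [tL LE]] := LA sf.
(* The Plancherel formula asks for a list that contains the support of [L f]. *)
pose u := s' ++ [seq v <- undup t | v \notin s'].
have uu : uniq u.
  rewrite cat_uniq us' filter_uniq ?undup_uniq// andbT.
  by apply/hasPn => v; rewrite mem_filter => /andP[].
have uL : supported u (L f).
  move=> v /tL vt; rewrite mem_cat mem_filter mem_undup vt andbT.
  by case: (v \in s').
apply: (@le_trans _ _ (\sum_(v <- u) nsq (L f v))).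
  by rewrite big_cat lerDl sumr_ge0// => v _; exact: nsq_ge0.
have [N1 E1] := plancherel P_actV us sf.
have [N2 E2] := plancherel P_actV uu uL.
pose N := (maxn N1 N2).+1.
have N0 : 0 < (N ^ d)%:R :> R by rewrite ltr0n expn_gt0.
rewrite -(ler_pM2l N0) -E2; last by rewrite leqW// leq_maxr.
rewrite mulrCA -E1; last by rewrite leqW// leq_maxl.
rewrite mulr_sumr; apply: ler_sum => k _.
by rewrite LE Aq//; exact: sample_cube.
Qed.

(** Each finite part of [L f] is also a finite part of [L f'], where [f'] is a
truncation of [f]. *)
Lemma bound_l2 f c : local_op L -> sqsum_le f c -> sqsum_le (L f) (q * c).
Proof.
move=> /choice[n nP] fc s us.
pose t := undup (flatten [seq n v | v <- s]).
pose f' v := if v \in t then f v else 0.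
have f't : supported t f'.
  by move=> v; rewrite /f'; case: ifP; rewrite ?eqxx.
have ut : uniq t by exact: undup_uniq.
have -> : \sum_(v <- s) nsq (L f v) = \sum_(v <- s) nsq (L f' v).
  apply: eq_big_seq => v vs; rewrite (nP v f f')// => u un.
  rewrite /f' mem_undup; case: ifPn => // /flattenP[].
  by exists (n v) => //; exact: map_f.
apply: le_trans (bound_finite ut f't us) _; rewrite ler_wpM2l//.
apply: le_trans (fc t ut); rewrite le_eqVlt; apply/orP; left; apply/eqP.
by apply: eq_big_seq => v vt; rewrite /f' vt.
Qed.

End FloquetBound.

(** * Pointwise convergence of complex functions *)

Section PointwiseConvergence.
Variable R : realType.
Local Notation C := (R[i]).

Definition cvgC (u : nat -> C) (l : C) :=
  (complex.Re (u n) @[n --> \oo] --> complex.Re l) /\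
  (complex.Im (u n) @[n --> \oo] --> complex.Im l).

Lemma cvgC_cst l : cvgC (fun=> l) l.
Proof. by split; exact: cvg_cst. Qed.

Lemma cvgCD u u' l l' : cvgC u l -> cvgC u' l' ->
  cvgC (fun n => u n + u' n) (l + l').
Proof.
have ReE (a b : C) : complex.Re (a + b) = complex.Re a + complex.Re b.
  by case: a; case: b.
have ImE (a b : C) : complex.Im (a + b) = complex.Im a + complex.Im b.
  by case: a; case: b.
move=> [r i] [r' i']; split.
  by rewrite ReE; under eq_cvg do rewrite ReE; exact: (cvgD r r').
by rewrite ImE; under eq_cvg do rewrite ImE; exact: (cvgD i i').
Qed.

Lemma cvgCZ a u l : cvgC u l -> cvgC (fun n => a * u n) (a * l).
Proof.
have ReE (y z : C) : complex.Re (y * z) =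
  complex.Re y * complex.Re z - complex.Im y * complex.Im z by case: y; case: z.
have ImE (y z : C) : complex.Im (y * z) =
  complex.Re y * complex.Im z + complex.Im y * complex.Re z by case: y; case: z.
have cst (x y : R) (w : nat -> R) : w n @[n --> \oo] --> y ->
    x * w n @[n --> \oo] --> x * y.
  by move=> wy; exact: (cvgM (cvg_cst x) wy).
move=> [r i]; split.
  by rewrite ReE; under eq_cvg do rewrite ReE; exact: (cvgB (cst _ _ _ r) (cst _ _ _ i)).
by rewrite ImE; under eq_cvg do rewrite ImE; exact: (cvgD (cst _ _ _ i) (cst _ _ _ r)).
Qed.

Lemma cvgC_sum I (r : seq I) (D : pred I) (u : I -> nat -> C) l :
  (forall i, D i -> cvgC (u i) (l i)) ->
  cvgC (fun n => \sum_(i <- r | D i) u i n) (\sum_(i <- r | D i) l i).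
Proof.
move=> ul; elim: r => [|i r IH].
  have -> : (fun n => \sum_(i <- [::] | D i) u i n) = fun=> 0.
    by apply/funext => n; rewrite big_nil.
  by rewrite big_nil; exact: cvgC_cst.
have -> : (fun n => \sum_(j <- i :: r | D j) u j n) =
    fun n => (if D i then u i n else 0) + \sum_(j <- r | D j) u j n.
  by apply/funext => n; rewrite big_cons; case: ifP; rewrite ?add0r.
have -> : \sum_(j <- i :: r | D j) l j =
    (if D i then l i else 0) + \sum_(j <- r | D j) l j.
  by rewrite big_cons; case: ifP; rewrite ?add0r.
apply: cvgCD => //; case: ifP => [/ul //|_]; exact: cvgC_cst.
Qed.

Lemma cvgC_unique u l l' : cvgC u l -> cvgC u l' -> l = l'.
Proof.
case: l => a b; case: l' => a' b' [r i] [r' i'] /=.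
by congr Complex; [exact: (cvg_unique _ r r') | exact: (cvg_unique _ i i')].
Qed.

Lemma cvgC_shift u l : cvgC u l -> cvgC (fun n => u n.+1) l.
Proof.
move=> [r i]; split.
  by rewrite (cvg_shiftS (fun n => complex.Re (u n))).
by rewrite (cvg_shiftS (fun n => complex.Im (u n))).
Qed.

Lemma cvg_geometric_increments (x : nat -> R) (a b : R) : 0 <= b < 1 ->
  (forall n, `|x n.+1 - x n| <= a * b ^+ n) -> cvgn x.
Proof.
move=> /andP[b0 b1] xab.
have a0 : 0 <= a by have := xab 0%N; rewrite expr0 mulr1; apply: le_trans.
rewrite (funext (eq_sum_telescope x)).
apply: is_cvgD; first exact: is_cvg_cst.
apply: normed_cvg; apply: (@series_le_cvg _ _ (fun n => a * b ^+ n)) => [n|n|n|].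
- exact: normr_ge0.
- by rewrite mulr_ge0 ?exprn_ge0.
- exact: xab.
- by apply: is_cvg_geometric_series; rewrite ger0_norm.
Qed.

Lemma cvgC_geometric_increments u (c q : R) : 0 <= q < 1 ->
  (forall n, nsq (u n.+1 - u n) <= q ^+ n * c) -> exists l, cvgC u l.
Proof.
move=> /andP[q0 q1] uq.
have s1 : 0 <= Num.sqrt q < 1.
  by rewrite sqrtr_ge0 -sqrtr1 ltr_sqrt.
have sq n : Num.sqrt (q ^+ n * c) = Num.sqrt c * Num.sqrt q ^+ n.
  rewrite sqrtrM ?exprn_ge0// mulrC; congr (_ * _).
  by elim: n => [|n IH]; rewrite ?sqrtr1// !exprS sqrtrM// IH.
have bound (x y : R) n : x ^+ 2 + y ^+ 2 <= q ^+ n * c ->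
    `|x| <= Num.sqrt c * Num.sqrt q ^+ n.
  move=> xy; rewrite -sq -sqrtr_sqr ler_wsqrtr// (le_trans _ xy)//.
  by rewrite lerDl sqr_ge0.
have cr : cvgn (fun n => complex.Re (u n)).
  apply: (cvg_geometric_increments (a := Num.sqrt c) s1) => n.
  have := bound _ _ _ (uq n); case: (u n.+1); case: (u n) => a b a' b' /=.
  by [].
have ci : cvgn (fun n => complex.Im (u n)).
  apply: (cvg_geometric_increments (a := Num.sqrt c) s1) => n.
  have := uq n; rewrite /nsq addrC => /bound.
  by case: (u n.+1); case: (u n).
exists (limn (fun n => complex.Re (u n)) +i* limn (fun n => complex.Im (u n))).
by split.
Qed.

Lemma sqsum_le_limit (V : choiceType) (u : nat -> V -> C) l c :
  (forall n, sqsum_le (u n) c) -> (forall v, cvgC (u^~ v) (l v)) -> sqsum_le l c.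
Proof.
move=> uc ul s us.
have sc : \sum_(v <- s) nsq (u n v) @[n --> \oo] --> \sum_(v <- s) nsq (l v).
  elim: (s) => [|v r IH].
    by rewrite big_nil; under eq_cvg do rewrite big_nil; exact: cvg_cst.
  rewrite big_cons; under eq_cvg do rewrite big_cons.
  apply: (cvgD _ IH); have [r' i'] := ul v.
  exact: (cvgD (cvgM r' r') (cvgM i' i')).
apply: (ler_cvg_to sc (cvg_cst c)); apply: nearW => n; exact: uc.
Qed.

End PointwiseConvergence.

(** * Inversion of an operator by a contraction *)

(** Young's inequality. *)
Lemma nsqD_le (R : realType) (a b : R[i]) (eta : R) : 0 < eta ->
  nsq (a + b) <= (1 + eta^-1) * nsq a + (1 + eta) * nsq b.
Proof.
move=> e0; case: a => a1 a2; case: b => b1 b2; rewrite /nsq /=.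
have young (x y : R) :
    (x + y) ^+ 2 <= (1 + eta^-1) * x ^+ 2 + (1 + eta) * y ^+ 2.
  rewrite -subr_ge0.
  have -> : (1 + eta^-1) * x ^+ 2 + (1 + eta) * y ^+ 2 - (x + y) ^+ 2 =
      (x - eta * y) ^+ 2 / eta by field; rewrite gt_eqF.
  by rewrite divr_ge0 ?sqr_ge0// ltW.
by have := young a1 b1; have := young a2 b2; lra.
Qed.

Section Resolvent.
Variables (R : realType) (V : choiceType).
Local Notation C := (R[i]).
Implicit Types (f g h : V -> C).

(** The geometric series is summed pointwise, and local linear operators
commute with pointwise limits. *)
Definition pointwise_continuous (L : (V -> C) -> V -> C) :=
  forall (u : nat -> V -> C) l, (forall v, cvgC (u^~ v) (l v)) ->
  forall v, cvgC (fun n => L (u n) v) (L l v).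

Definition linear_op (L : (V -> C) -> V -> C) :=
  forall (a : C) f g, L (fun v => f v - a * g v) = fun v => L f v - a * L g v.

Variables (B : (V -> C) -> V -> C) (t q M : R).
Let K f v := f v - t%:C * B (B f) v.
Hypothesis q01 : 0 <= q < 1.
Hypothesis Klt : forall f c, sqsum_le f c -> sqsum_le (K f) (q * c).
Hypothesis Ble : forall f c, sqsum_le f c -> sqsum_le (B f) (M * c).
Hypothesis Blin : linear_op B.
Hypothesis Bcont : pointwise_continuous B.

Lemma sqsum_le_ge0 f c : sqsum_le f c -> 0 <= c.
Proof. by move=> /(_ [::] isT); rewrite big_nil. Qed.

Lemma sqsum_leZ (a : C) f c : sqsum_le f c ->
  sqsum_le (fun v => a * f v) (nsq a * c).
Proof.
move=> fc s us; under eq_bigr do rewrite nsqM.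
by rewrite -mulr_sumr ler_wpM2l ?nsq_ge0//; exact: fc.
Qed.

Lemma sqsum_leD f g c c' (eta : R) : 0 < eta -> sqsum_le f c -> sqsum_le g c' ->
  sqsum_le (fun v => f v + g v) ((1 + eta^-1) * c + (1 + eta) * c').
Proof.
move=> e0 fc gc s us.
apply: (@le_trans _ _ (\sum_(v <- s)
  ((1 + eta^-1) * nsq (f v) + (1 + eta) * nsq (g v)))).
  by apply: ler_sum => v _; exact: nsqD_le.
rewrite big_split/= -!mulr_sumr; apply: lerD; apply: ler_wpM2l.
- by rewrite addr_ge0// invr_ge0 ltW.
- exact: fc.
- by rewrite addr_ge0// ltW.
- exact: gc.
Qed.

Lemma linear_op0 : B (fun=> 0) = fun=> 0.
Proof.
have := Blin 1 (fun=> 0) (fun=> 0).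
have -> : (fun v : V => (0 : C) - 1 * 0) = fun=> 0.
  by apply/funext => v; rewrite mulr0 subr0.
by move=> ->; apply/funext => v; rewrite mul1r subrr.
Qed.

Lemma linear_opZ (a : C) f : B (fun v => a * f v) = fun v => a * B f v.
Proof.
have := Blin (- a) (fun=> 0) f; rewrite linear_op0.
have -> : (fun v => 0 - - a * f v) = fun v => a * f v.
  by apply/funext => v; rewrite sub0r mulNr opprK.
by move=> ->; apply/funext => v; rewrite sub0r mulNr opprK.
Qed.

Lemma KB f g : K (fun v => f v - g v) = fun v => K f v - K g v.
Proof.
have one h1 h2 : (fun v => h1 v - h2 v) = fun v => h1 v - 1 * h2 v :> C.
  by apply/funext => v; rewrite mul1r.
apply/funext => v; rewrite /K one Blin Blin.
by ring.
Qed.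

Lemma K0 : K (fun=> 0) = fun=> 0.
Proof. by apply/funext => v; rewrite /K !linear_op0 mulr0 subr0. Qed.

(** A function killed by [B] is fixed by the contraction [K]. *)
Lemma kernel_trivial h c : sqsum_le h c -> B h = (fun=> 0) -> h = fun=> 0.
Proof.
move=> hc Bh0; have Kh : K h = h.
  by apply/funext => v; rewrite /K Bh0 linear_op0 mulr0 subr0.
have /in_l2P[c0 c00 hE] : in_l2 h.
  by rewrite /in_l2 (@le_lt_trans _ _ c%:E) ?ltry//; apply/l2norm_le.
have hc0 : sqsum_le h c0 by apply/l2norm_le; rewrite hE.
have : (l2norm_sq h <= (q * c0)%:E)%E by apply/l2norm_le; rewrite -Kh; exact: Klt.
rewrite hE lee_fin => c0q.
have c0_0 : c0 = 0 by case/andP: q01 => q0 q1; nra.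
apply/funext => v; apply/eqP; rewrite -nsq_eq0 eq_le nsq_ge0 andbT.
by have := hc0 [:: v] isT; rewrite big_seq1 c0_0.
Qed.

(** Partial sums of the geometric series of [K], applied to [g]. *)
Fixpoint iterates g n : V -> C :=
  if n is n'.+1 then fun v => g v + K (iterates g n') v else fun=> 0.

Lemma iterates_increment g c n : sqsum_le g c ->
  sqsum_le (fun v => iterates g n.+1 v - iterates g n v) (q ^+ n * c).
Proof.
move=> gc; elim: n => [|n IH].
  rewrite /= K0 mul1r => s us.
  by under eq_bigr do rewrite addr0 subr0; exact: gc.
have -> : (fun v => iterates g n.+2 v - iterates g n.+1 v) =
    K (fun v => iterates g n.+1 v - iterates g n v).
  by rewrite KB; apply/funext => v /=; rewrite opprD addrACA subrr add0r.
by rewrite exprS -mulrA; exact: Klt.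
Qed.

(** The fixed point of the recursive bound in [iterates_bound], where Young's
inequality is used with weight 1 - [q]: then (1 + (1 - q)) q = 1 - (1 - q)^2. *)
Let gain : R := (1 + (1 - q)^-1) / (1 - q) ^+ 2.

Lemma iterates_bound g c n : sqsum_le g c -> sqsum_le (iterates g n) (gain * c).
Proof.
move=> gc; have c0 := sqsum_le_ge0 gc; case/andP: (q01) => q0 q1.
have eta0 : 0 < 1 - q by rewrite subr_gt0.
have k0 : 0 <= gain by rewrite divr_ge0 ?sqr_ge0// addr_ge0// invr_ge0 ltW.
elim: n => [s us|n IH].
  by rewrite /= big1 ?(mulr_ge0 k0 c0)// => v _; exact: nsq0.
have -> : gain * c =
   (1 + (1 - q)^-1) * c + (1 + (1 - q)) * (q * (gain * c)).
  by rewrite /gain; field; rewrite gt_eqF.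
by apply: sqsum_leD => //; exact: Klt.
Qed.

(** The limit satisfies l = g + K l, and 1 - K is t B^2. *)
Lemma iterates_limit g c : sqsum_le g c ->
  exists2 l, sqsum_le l (gain * c) & forall v, t%:C * B (B l) v = g v.
Proof.
move=> gc.
have /choice[l lP] v : exists l, cvgC (fun n => iterates g n v) l.
  apply: (cvgC_geometric_increments q01 (c := c)) => n.
  by have := iterates_increment n gc (s := [:: v]) isT; rewrite big_seq1.
exists l.
  by apply: (sqsum_le_limit _ lP) => n; exact: iterates_bound.
move=> v; have Kcont : cvgC (fun n => iterates g n.+1 v) (g v + K l v).
  apply: cvgCD (cvgC_cst _) _; rewrite /K -mulNr.
  have -> : (fun n => iterates g n v - t%:C * B (B (iterates g n)) v) =
      fun n => iterates g n v + - t%:C * B (B (iterates g n)) v.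
    by apply/funext => n; rewrite mulNr.
  apply: cvgCD (lP v) (cvgCZ _ _).
  by apply: Bcont => w; exact: Bcont.
have := cvgC_unique (cvgC_shift (lP v)) Kcont.
rewrite /K => /eqP; rewrite addrCA -subr_eq0 opprD addrA subrr add0r.
rewrite oppr_eq0 subr_eq0 => /eqP.
by [].
Qed.

(** The series inverts t B^2; composing it with t B gives the inverse of [B]. *)
Lemma bounded_inverse : exists (S : (V -> C) -> V -> C) (M' : R),
  forall f, in_l2 f -> [/\ (l2norm_sq (S f) <= M'%:E * l2norm_sq f)%E,
    B (S f) = f & S (B f) = f].
Proof.
pose M' := nsq t%:C * (M * gain).
have solve g : exists w, forall c, sqsum_le g c ->
    sqsum_le w (M' * c) /\ B w = g.
  have [gl2|gl2] := pselect (in_l2 g); last first.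
    exists (fun=> 0) => c /l2norm_le gc; case: gl2.
    by rewrite /in_l2 (le_lt_trans gc) ?ltry.
  have [c c0 gE] : exists2 c, 0 <= c & l2norm_sq g = c%:E by exact/in_l2P.
  have gc : sqsum_le g c by apply/l2norm_le; rewrite gE.
  have [l lc lE] := iterates_limit gc.
  exists (fun v => t%:C * B l v) => c' gc'; split; last first.
    by rewrite linear_opZ; apply/funext.
  have cc' : c <= c' by rewrite -lee_fin -gE; apply/l2norm_le.
  rewrite /M' -mulrA; apply: sqsum_leZ; rewrite -mulrA.
  apply: Ble => s us; apply: le_trans (lc s us) _.
  rewrite ler_wpM2l// divr_ge0 ?sqr_ge0// addr_ge0// invr_ge0 subr_ge0.
  by case/andP: q01 => _ /ltW.
have /choice[S SP] := solve; exists S, M' => f /in_l2P[c c0 fE].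
have fc : sqsum_le f c by apply/l2norm_le; rewrite fE.
have [Sc SE] := SP f c fc; split => //.
  by rewrite fE -EFinM; apply/l2norm_le.
have [SBc SBE] := SP (B f) _ (Ble fc).
apply/funext => v; apply/eqP; rewrite -subr_eq0; apply/eqP.
pose h v := S (B f) v + - 1 * f v.
suff : h = fun=> 0 by move=> /(congr1 (@^~ v)); rewrite /h mulN1r.
have hc := sqsum_leD ltr01 SBc (sqsum_leZ (- 1) fc).
apply: (kernel_trivial hc).
have -> : (fun v => S (B f) v + - 1 * f v) = fun v => S (B f) v - 1 * f v.
  by apply/funext => w; rewrite mulNr.
by rewrite Blin SBE; apply/funext => w; rewrite mul1r subrr.
Qed.

End Resolvent.

(** * The spectrum is contained in the bands *)

Section Spectrum.
Variables (R : realType) (d : nat) (G : periodicGraph R d).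
Variables (Q : vertex G -> R) (m : oneForm G).
Hypothesis Qper : periodic_potential Q.
Local Notation C := (R[i]).
Local Notation V := (fvertex G).
Local Notation H := (schrodinger G Q).
Implicit Types (f : vertex G -> C).

Lemma schrodinger_local : local_op H.
Proof.
move=> v; exists (v :: [seq neighbour e v | e <- enum (fedge G)]) => f g fg.
rewrite !schrodingerE fg ?mem_head//; congr (_ - _ + _).
apply: eq_bigr => e _; apply: fg; rewrite inE; apply/orP; right.
by apply: map_f; rewrite mem_enum.
Qed.

Lemma schrodinger_linear : linear_op H.
Proof.
move=> a f g; apply/funext => v; rewrite !schrodingerE sumrB -mulr_sumr.
by ring.
Qed.

Lemma schrodinger_continuous : pointwise_continuous H.
Proof.
move=> u l ul v.
have -> : (fun n => H (u n) v) = fun n =>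
    ((degree (fund_graph G) (projV v))%:R * u n v +
     -1 * \sum_(e | src (fund_graph G) e == projV v) u n (neighbour e v)) +
     (Q v)%:C * u n v.
  by apply/funext => n; rewrite schrodingerE mulN1r.
rewrite schrodingerE -(mulN1r (\sum_(e | _) _)).
apply: cvgCD; last exact: cvgCZ.
apply: cvgCD; first exact: cvgCZ.
by apply: cvgCZ; apply: cvgC_sum => e _; exact: ul.
Qed.

Definition resolvent_op (x : R) f v : C := H f v - x%:C * f v.

Lemma resolvent_op_linear x : linear_op (resolvent_op x).
Proof.
move=> a f g; rewrite /resolvent_op schrodinger_linear; apply/funext => v.
by ring.
Qed.

Lemma resolvent_op_continuous x : pointwise_continuous (resolvent_op x).
Proof.
move=> u l ul v; rewrite /resolvent_op -mulNr.
have -> : (fun n => H (u n) v - x%:C * u n v) =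
    fun n => H (u n) v + - x%:C * u n v by apply/funext => n; rewrite mulNr.
by apply: cvgCD (cvgCZ _ (ul v)); exact: schrodinger_continuous.
Qed.

Hypothesis mF : in_F_kappa m.

(** If [x] avoids the bands, all the numbers (lambda - x)^2 lie in a fixed interval
that excludes 0, and with t the inverse of an upper bound [N], the numbers
1 - t (lambda - x)^2 lie between 0 and a constant smaller than 1. *)
Lemma sigma_subset_bands x : sigma Q x ->
  exists k theta, (k < #|V|)%N /\ lambda Q m k theta = x.
Proof.
apply: contraPP => noband; apply; rewrite /resolvent_set /=.
have xout k theta : (k < #|V|)%N -> lambda Q m k theta != x.
  by move=> kn; apply/eqP => lx; apply: noband; exists k, theta.
have [delta d0 gapP] := bands_at_distance xout.
pose b : R := \sum_(k < #|V|) `|mu Q m k| + 2 * (kappa_plus m)%:R + `|x|.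
pose N : R := b ^+ 2 + 1.
(* Capped at 1, since the square must not exceed [N]. *)
pose delta' : R := Num.min delta 1.
have d'0 : 0 < delta' by rewrite lt_min d0 ltr01.
have d'1 : delta' ^+ 2 <= 1 by rewrite expr_le1 ?ge_min ?lexx ?orbT// ltW.
have N1 : 1 <= N by rewrite lerDr sqr_ge0.
have N0 : 0 < N by rewrite (lt_le_trans ltr01).
have upper k theta : (k < #|V|)%N -> (lambda Q m k theta - x) ^+ 2 <= N.
  move=> kn; apply: (@le_trans _ _ (b ^+ 2)); last by rewrite lerDl.
  have b0 : 0 <= b by rewrite !addr_ge0 ?sumr_ge0 ?mulr_ge0.
  rewrite -ler_sqrt ?sqr_ge0// !sqrtr_sqr (ger0_norm b0).
  have lo := mu_le_lambda Q m theta kn.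
  have up := le_trans (lambda_le_upper Q m theta kn) (upper_le_mu Q m kn).
  have muk : `|mu Q m k| <= \sum_(k < #|V|) `|mu Q m k|.
    by rewrite (bigD1 (Ordinal kn))//= lerDl sumr_ge0.
  apply: le_trans (ler_normB _ _) _; rewrite lerD2r.
  apply: (@le_trans _ _ (`|mu Q m k| + 2 * (kappa_plus m)%:R)); last by rewrite lerD2r.
  have := ler_norm (mu Q m k); have := ler_norm (- mu Q m k); rewrite normrN.
  by move=> h1 h2; rewrite ler_norml; apply/andP; split; lra.
have lower k theta : (k < #|V|)%N -> cube theta ->
    delta' ^+ 2 <= (lambda Q m k theta - x) ^+ 2.
  move=> kn tc; rewrite -[leRHS]real_normK ?num_real//.
  rewrite lerXn2r ?nnegrE ?(ltW d'0)//.
  by apply: le_trans (gapP _ _ kn tc); rewrite ge_min lexx.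
have [P [P_actV P_neighbour]] := gauge_position mF.
have Hs := has_symbol_schrodinger P_neighbour Qper.
have Bs := has_symbolB x%:C Hs (has_symbol_id P).
have Ks := has_symbolB (N^-1)%:C (has_symbol_id P) (has_symbol_comp Bs Bs).
have Bl := localB x%:C schrodinger_local (@local_id _ _).
have Kl := localB (N^-1)%:C (@local_id _ _) (local_comp Bl Bl).
pose q := (1 - N^-1 * delta' ^+ 2) ^+ 2.
have dN : 0 < N^-1 * delta' ^+ 2 <= 1.
  rewrite mulr_gt0 ?invr_gt0 ?exprn_gt0//= mulrC ler_pdivrMr// mul1r.
  exact: le_trans N1.
have q01 : 0 <= q < 1.
  by rewrite /q sqr_ge0 /= expr_lt1//; lra.
have bounded f c : sqsum_le f c -> sqsum_le (resolvent_op x f) (N * c).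
  apply: (bound_l2 P_actV Bs) Bl; first exact: ltW.
  by move=> theta g _; apply: (shift_bound _ (fiber_selfadjoint Q m theta)) => k kn;
     exact: upper.
have contraction f c : sqsum_le f c ->
    sqsum_le (fun v => f v - (N^-1)%:C * resolvent_op x (resolvent_op x f) v) (q * c).
  apply: (bound_l2 P_actV Ks) Kl; first by case/andP: q01.
  move=> theta g tc.
  apply: (richardson_bound _ (fiber_selfadjoint Q m theta)) => k kn.
  have := lower _ _ kn tc; have := upper k theta kn.
  rewrite -/(lambda Q m k theta) => up lo.
  rewrite lerXn2r ?nnegrE//; last first.
  - by rewrite lerD2l lerN2 ler_pM2l ?invr_gt0.
  - by case/andP: dN; lra.
  - by rewrite subr_ge0 mulrC ler_pdivrMr// mul1r.
exact: (bounded_inverse q01 contraction bounded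
  (resolvent_op_linear x) (@resolvent_op_continuous x)).
Qed.

End Spectrum.

(** * Lebesgue measure of the spectrum and of the bands *)

Section Measure.
Variable R : realType.
Implicit Types A B : set R.

(** The sets are arbitrary: the Lebesgue measure is given on all sets by the formula
of the outer measure. *)
Lemma lebesgue_measure_mono A B :
  A `<=` B -> (lebesgue_measure A <= lebesgue_measure B)%E.
Proof. exact: (le_outer_measure (wlength idfun)^*%mu). Qed.

Lemma lebesgue_measure_cover (N : nat) (F : nat -> set R) A :
  (forall x, A x -> exists n, (n < N)%N /\ F n x) ->
  (lebesgue_measure A <= \sum_(n < N) lebesgue_measure (F n))%E.
Proof.
elim: N A => [|N IH] A AF.
  rewrite big_ord0 (_ : A = set0) ?measure0//.
  by apply/seteqP; split => // x /AF[n []].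
rewrite big_ord_recr/=.
apply: (@le_trans _ _ (lebesgue_measure (A `\` F N) + lebesgue_measure (F N))%E).
  apply: (@le_trans _ _ (lebesgue_measure ((A `\` F N) `|` F N))).
    apply: lebesgue_measure_mono => x Ax.
    by have [Fx|Fx] := pselect (F N x); [right | left].
  exact: (outer_measureU2 (wlength idfun)^*%mu).
rewrite leeD2r// IH// => x [/AF[n [nN Fx]] nFx]; exists n; split => //.
move: nN; rewrite ltnS leq_eqVlt => /orP[/eqP nN|//].
by rewrite nN in Fx.
Qed.

Lemma lebesgue_measure_segment (a b : R) : a <= b ->
  lebesgue_measure `[a, b]%classic = (b - a)%:E.
Proof.
move=> ab; rewrite lebesgue_measure_itv/= lte_fin.
by case: ltgtP ab => // -> _; rewrite subrr.
Qed.

End Measure.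

Section Bands.
Variables (R : realType) (d : nat) (G : periodicGraph R d).
Variables (Q : vertex G -> R) (m : oneForm G).
Local Notation V := (fvertex G).

Lemma band_subset (n : 'I_#|V|) : band Q m n `<=`
  `[mu Q m n, mu Q m n + 2 * (kappa_plus m)%:R]%classic.
Proof.
move=> _ [theta _ <-] /=; rewrite in_itv/=; apply/andP; split.
  exact: mu_le_lambda.
exact: le_trans (lambda_le_upper _ _ _ _) (upper_le_mu _ _ _).
Qed.

Lemma measure_spectrum_le : periodic_potential Q -> in_F_kappa m ->
  (lebesgue_measure (sigma Q) <= \sum_(n < #|V|) lebesgue_measure (band Q m n))%E.
Proof.
move=> Qper mF; apply: lebesgue_measure_cover => x.
move=> /(sigma_subset_bands Qper mF)[k [theta [kn lx]]].
by exists k; split => //; exists theta.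
Qed.

Lemma sum_measure_bands_le :
  (\sum_(n < #|V|) lebesgue_measure (band Q m n) <= (4 * calI m)%:E)%E.
Proof.
rewrite -(sum_enclosure_length Q m) -sumEFin; apply: lee_sum => n _.
have mn : mu Q m n <= nth 0 (eigenvalues (upper_op Q m)) n.
  exact: le_trans (mu_le_lambda Q m 0 (ltn_ord n)) (lambda_le_upper _ _ _ _).
rewrite -lebesgue_measure_segment//; apply: lebesgue_measure_mono.
move=> _ [theta _ <-] /=.
by rewrite in_itv/=; apply/andP; split; [exact: mu_le_lambda | exact: lambda_le_upper].
Qed.

End Bands.

(** * The lattice graph with additional loops *)

Lemma nsq_sum_le (R : realType) (I : finType) (a : I -> R[i]) :
  (forall i, nsq (a i) <= 1) -> nsq (\sum_i a i) <= #|I|%:R ^+ 2.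
Proof.
move=> a1; rewrite -nsq_normc lerXn2r ?nnegrE//.
  by case: (\sum_i _) => x x'; rewrite /= sqrtr_ge0.
rewrite -[leRHS]mulr1 mulr_natl -sumr_const.
elim/big_rec2: _ => [|i x z _ zx]; first by rewrite Normc.normc0.
apply: le_trans (le_normcD _ _) _; apply: lerD => //.
rewrite -(@ler_sqr _ _ 1) ?nnegrE//; last by case: (a i) => u u'; exact: sqrtr_ge0.
by rewrite nsq_normc expr1n.
Qed.

(** The boundary of a box grows one order slower than its volume. *)
Lemma volume_dominates_boundary (R : realType) (k : nat) (C : R) :
  (0 < k)%N -> 0 <= C ->
  exists N, C * ((N.+4 ^ k)%:R - (N ^ k)%:R) < (N.+2 ^ k)%:R.
Proof.
case: k => // k _ C0.
pose c := C * (4 * k.+1%:R * 2 ^+ k).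
have c0 : 0 <= c by rewrite !mulr_ge0 ?exprn_ge0.
exists (Num.bound c); set N := Num.bound c.
have cN : c < N.+2%:R.
  apply: lt_le_trans (archi_boundP c0) _; by rewrite ler_nat leqW.
have pow : (N.+4 ^ k.+1)%:R - (N ^ k.+1)%:R <=
    4 * k.+1%:R * 2 ^+ k * N.+2%:R ^+ k :> R.
  rewrite !natrX subrXX -!mulrA.
  have -> : N.+4%:R - N%:R = 4 :> R by rewrite -addn4 natrD addrAC subrr add0r.
  rewrite ler_pM2l// mulr_natl -exprMn.
  apply: (@le_trans _ _ (\sum_(i < k.+1) (2 * N.+2%:R) ^+ k)); last first.
    by rewrite sumr_const card_ord.
  apply: ler_sum => i _; have ik : (i <= k)%N by rewrite -ltnS.
  apply: (@le_trans _ _ (N.+4%:R ^+ (k - i) * N.+4%:R ^+ i)).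
    by rewrite ler_wpM2l ?exprn_ge0// lerXn2r ?nnegrE// ler_nat -addn4 leq_addr.
  rewrite -exprD subnK// lerXn2r ?nnegrE ?mulr_ge0//.
  by rewrite -natrM ler_nat mul2n -addnn; lia.
apply: (@le_lt_trans _ _ (c * N.+2%:R ^+ k)).
  by rewrite /c -!mulrA ler_wpM2l// !mulrA.
by rewrite natrX exprS ltr_pM2r// exprn_gt0.
Qed.

Section Bouquet.
Variables (R : realType) (k n : nat).
Hypothesis k0 : (0 < k)%N.
Local Notation Z := ('rV[int]_k).
Local Notation E := ('I_n * bool)%type.
Implicit Types (u v w z : Z) (e : E).

Definition opposite e : E := (e.1, ~~ e.2).

Lemma oppositeK : involutive opposite.
Proof. by case=> i b; rewrite /opposite /= negbK. Qed.

Lemma oppositeN e : opposite e <> e.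
Proof. by case: e => i [] []. Qed.

(** The boolean is the orientation of the loop. *)
Definition bouquet : graph unit E :=
  @Graph unit E (fun=> tt) (fun=> tt) opposite oppositeK oppositeN (fun=> erefl).

(** Zero for the loops of index [k] and more, as no coordinate has that index; these
loops raise the Betti number without changing the operator. *)
Definition step e : Z := \row_s (if val s == val e.1 then (-1) ^+ e.2 else 0).

Lemma step_opposite e : step (opposite e) = - step e.
Proof.
apply/rowP => s; rewrite !mxE /=; case: ifP => _; last by rewrite oppr0.
by case: e.2; rewrite ?expr1 ?expr0 ?opprK.
Qed.

Definition cover_orev (x : Z * E) : Z * E := (x.1 + step x.2, opposite x.2).

Lemma cover_orevK : involutive cover_orev.
Proof.
by case=> v e; rewrite /cover_orev /= step_opposite addrK oppositeK.
Qed.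

Lemma cover_orevN x : cover_orev x <> x.
Proof. by move=> /(congr1 snd); exact: oppositeN. Qed.

Definition cover : graph Z (Z * E) :=
  @Graph Z (Z * E)%type (fun x => x.1) (fun x => x.1 + step x.2)
    cover_orev cover_orevK cover_orevN (fun=> erefl).

Lemma cover_infinite : infinite_set [set: Z].
Proof.
move=> /(finite_image (fun z : Z => absz (z 0 (Ordinal k0)))).
have -> : (fun z : Z => absz (z 0 (Ordinal k0))) @` [set: Z] = [set: nat].
  by apply/seteqP; split => // p _; exists (const_mx p%:Z); rewrite ?mxE.
exact: infinite_nat.
Qed.

Hypothesis kn : (k <= n)%N.

Let reach u v := exists p, walk cover u p v.

Lemma reach_trans u v w : reach u v -> reach v w -> reach u w.
Proof. by move=> [p up] [q vq]; exists (p ++ q); exact: walk_cat up vq. Qed.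

Lemma reach_step u e : reach u (u + step e).
Proof. by exists [:: (u, e)]. Qed.

Lemma reach_multiple u v (a : int) :
  (forall w, reach w (w + v)) -> (forall w, reach w (w - v)) ->
  reach u (u + v *~ a).
Proof.
move=> vp vn; case: a => p.
  elim: p => [|p IH]; first by exists [::]; rewrite /= mulr0z addr0.
  rewrite intS mulrzDr [v *~ 1 + _]addrC addrA; apply: reach_trans IH _.
  by rewrite mulr1z.
rewrite NegzE; elim: p => [|p IH]; first by rewrite mulrNz mulr1z.
rewrite [p.+2%:Z]intS opprD mulrzDr [v *~ _ + _]addrC addrA.
apply: reach_trans IH _.
by rewrite mulrN1z.
Qed.

Lemma cover_connected : connected_graph cover.
Proof.
move=> u v; rewrite -[v](subrK u) addrC.
have sumE z : z = \sum_s (delta_mx 0 s : Z) *~ z 0 s.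
  apply/rowP => j; rewrite summxE (bigD1 j)//= big1 => [|s sj].
    by rewrite addr0 -scaler_int mxE mxE !eqxx mulr1 intz.
  by rewrite -scaler_int !mxE eqxx eq_sym (negbTE sj) mulr0.
rewrite [v - u]sumE; move: (v - u) => z.
elim/big_rec: _ u => [|s w _ IH] u; first by exists [::]; rewrite /= addr0.
rewrite addrA; apply: reach_trans (IH _).
have stepE b : step (widen_ord kn s, b) = (-1) ^+ b *: delta_mx 0 s.
  by apply/rowP => j; rewrite !mxE /= val_eqE; case: (j == s); rewrite ?mulr1 ?mulr0.
apply: reach_multiple => w'.
  by have := reach_step w' (widen_ord kn s, false); rewrite stepE scale1r.
by have := reach_step w' (widen_ord kn s, true); rewrite stepE scaleN1r.
Qed.

Lemma cover_locfin v : finite_set [set x | src cover x = v].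
Proof.
apply: (@sub_finite_set _ _ ((fun e => (v, e)) @` [set: E])).
  by move=> [w e] /= <-; exists e.
exact/finite_image/finite_finset.
Qed.

Definition cover_pos v : 'rV[R]_k := map_mx intr v.

Lemma cover_pos_inj : injective cover_pos.
Proof.
move=> u v /rowP uv; apply/rowP => i; have := uv i; rewrite !mxE.
exact: intr_inj.
Qed.

Lemma cover_pos_translate z v :
  cover_pos (v + z) = cover_pos v + lattice_vec 1%:M z.
Proof. by rewrite /lattice_vec mulmx1 /cover_pos map_mxD. Qed.

Definition bouquet_cover : periodicGraph R k.
Proof.
refine (@PeriodicGraph R k 1%:M (unitmx1 _ _) Z (Z * E)%type cover cover_pos
  cover_pos_inj cover_infinite cover_connected cover_locfin
  (fun z v => v + z) (fun z x => (x.1 + z, x.2)) cover_pos_translate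
  _ _ _ _ _ unit E bouquet (fun=> tt) snd _ _ _ _ _ _ _).
- by case=> v e; rewrite addr0.
- by move=> z w [v e] /=; rewrite addrA addrAC.
- by [].
- by move=> z [v e] /=; rewrite addrAC.
- by move=> z [v e]; rewrite /cover_orev /= addrAC.
- by case; exists 0.
- by move=> e; exists (0, e).
- by move=> u v; split=> // _; exists (v - u); rewrite addrC subrK.
- move=> [u e] [v f] /=; split=> [->|[z [_ ->]]//].
  by exists (v - u); rewrite addrC subrK.
- by [].
- by [].
- by [].
Defined.

Local Notation G := bouquet_cover.

Lemma kappaE e : kappa G e = cover_pos (step e).
Proof.
have -> : kappa G e = edge_coords (G := G) ((0, e) : oedge G).
  by rewrite -kappa_funE.
rewrite /edge_coords /coords /= invmx1 !mulmx1 add0r /cover_pos.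
by rewrite map_mx0 subr0.
Qed.

Lemma step_eq0 e : (step e == 0) = (k <= e.1)%N.
Proof.
apply/eqP/idP => [/rowP s0|ke].
  rewrite leqNgt; apply/negP => ek; have := s0 (Ordinal ek).
  by rewrite !mxE /= eqxx => /eqP; rewrite signr_eq0.
apply/rowP => s; rewrite !mxE; case: eqP => // se.
by have := ltn_ord s; rewrite ltnNge se ke.
Qed.

Lemma supp_kappa : supp (kappa G) = [set e : E | (e.1 < k)%N]%SET.
Proof.
apply/setP => e; rewrite !inE ltnNge -step_eq0; congr (~~ _).
rewrite kappaE; apply/eqP/eqP => [|->]; last by rewrite /cover_pos map_mx0.
have {1}<- : cover_pos 0 = 0 by rewrite /cover_pos map_mx0.
exact: cover_pos_inj.
Qed.

Lemma card_low : #|[set i : 'I_n | (i < k)%N]%SET| = k.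
Proof.
rewrite -sum1_card; under eq_bigl do rewrite inE.
by rewrite (big_ord_narrow kn)/= sum1_card card_ord.
Qed.

Lemma card_supp_kappa : #|supp (kappa G)| = (k * 2)%N.
Proof.
rewrite supp_kappa.
have -> : [set e : E | (e.1 < k)%N]%SET =
    finset.setX [set i : 'I_n | (i < k)%N]%SET [set: bool]%SET.
  by apply/setP => -[i b]; rewrite !inE andbT.
by rewrite cardsX card_low cardsT card_bool.
Qed.

Lemma calI_bouquet : calI (kappa G) = k%:R :> R.
Proof. by rewrite /calI card_supp_kappa natrM mulfK// pnatr_eq0. Qed.

(** Every loop of the one-vertex graph is a cycle, so the flux determines the form. *)
Lemma minimal_bouquet : minimal_form (kappa G).
Proof.
split=> // b bF; suff -> : supp b = supp (kappa G) by [].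
apply/setP => e; rewrite !inE.
have cyc : is_cycle (fund_graph G) [:: e] by exists tt.
by have := bF _ cyc; rewrite /flux !big_seq1 => ->.
Qed.

Lemma betti_bouquet : betti (fund_graph G) = n%:Z.
Proof.
rewrite /betti card_unit subrK.
suff -> : #|uedges (fund_graph G)| = n by [].
have -> : uedges (fund_graph G) =
    [set [set (i, false); (i, true)]%SET | i : 'I_n]%SET.
  apply/setP => A; apply/imsetP/imsetP => -[].
    move=> [i b] _ ->; exists i => //=.
    by case: b; rewrite // finset.setUC.
  by move=> i _ ->; exists (i, false).
rewrite card_imset ?card_ord// => i j /setP/(_ (i, false)).
by rewrite !inE eqxx /= => /esym/orP[]/eqP[].
Qed.

Variable Q : vertex G -> R.
Hypothesis Qper : periodic_potential Q.
Let q := Q (0 : Z).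

Lemma potential_constant v : Q v = q.
Proof. by rewrite /q -(Qper v (0 : Z)) /= add0r. Qed.

Lemma schrodinger_bouquetE (f : Z -> R[i]) v :
  schrodinger G Q f v =
  (n * 2)%:R * f v - \sum_e f (v + step e) + q%:C * f v.
Proof.
rewrite schrodingerE potential_constant; congr (_ * _ - _ + _).
  rewrite /degree; congr (_%:R); rewrite -[in RHS](card_ord n) -card_bool -card_prod.
  by apply: eq_card => e; rewrite !inE.
by apply: eq_bigr => e _; congr f; exact: (neighbourE (G := G) ((v, e) : oedge G)).
Qed.


(** The plane wave of quasimomentum (t, ..., t); one parameter already sweeps all the
energies of the band. *)
Variable t : R.

Definition height v : R := (\sum_s v 0 s)%:~R.

Definition plane v : R[i] := cexpi (t * height v).

Lemma planeD u v : plane (u + v) = plane u * plane v.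
Proof.
rewrite /plane -cexpiD -mulrDr -rmorphD/= -big_split/=.
by congr (cexpi (t * _%:~R)); apply: eq_bigr => s _; rewrite mxE.
Qed.

Lemma height_step e : height (step e) = if (e.1 < k)%N then (-1) ^+ e.2 else 0.
Proof.
rewrite /height; case: ifPn => [ek|]; last first.
  rewrite -leqNgt -step_eq0 => /eqP ->.
  by rewrite big1 // => s _; rewrite mxE.
rewrite (bigD1 (Ordinal ek))//= big1 ?addr0 => [|s sk].
  by rewrite mxE eqxx; case: e.2; rewrite ?expr1 ?rmorphN ?expr0 ?rmorph1.
by rewrite mxE ifN//; apply: contraNN sk => /eqP sk; apply/eqP/val_inj.
Qed.

Lemma sum_plane_step :
  \sum_e plane (step e) = ((n * 2)%:R - (2 * k%:R * (1 - cos t)))%:C.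
Proof.
have bool_sum (F : E -> R[i]) : \sum_e F e = \sum_i (F (i, true) + F (i, false)).
  transitivity (\sum_i \sum_b F (i, b)).
    by rewrite pair_bigA /=; apply: eq_bigr => -[].
  by apply: eq_bigr => i _; rewrite big_bool.
rewrite bool_sum /plane.
under eq_bigr => i _.
  rewrite !height_step /= (_ : _ + _ =
    (2 - (if (i < k)%N then 2 * (1 - cos t) else 0))%:C); last first.
    case: ifP => _; apply/eqP; rewrite eq_complex /=.
      rewrite expr1 expr0 mulrN1 mulr1 cosN sinN addNr eqxx andbT.
      by apply/eqP; ring.
    by rewrite mulr0 cos0 sin0 addr0 eqxx andbT; apply/eqP; ring.
  over.
rewrite -real_complex_sum sumrB sumr_const card_ord; congr (_%:C); congr (_ - _).
  by rewrite natrM mulr_natl.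
rewrite -big_mkcond/= sumr_const mulrAC mulr_natr; congr (_ *+ _).
by rewrite -[RHS]card_low; apply: eq_card => i; rewrite !inE.
Qed.

Let y := q + 2 * k%:R * (1 - cos t).

(** The plane wave has energy [y], so after multiplication by [chi] the residual sees
only the differences of [chi] along edges. *)
Lemma truncated_plane (chi : Z -> R[i]) v :
  schrodinger G Q (fun u => chi u * plane u) v - y%:C * (chi v * plane v) =
  plane v * \sum_e (chi v - chi (v + step e)) * plane (step e).
Proof.
rewrite schrodinger_bouquetE.
have -> : \sum_e (chi v - chi (v + step e)) * plane (step e) =
    chi v * \sum_e plane (step e) - \sum_e chi (v + step e) * plane (step e).
  by rewrite mulr_sumr -sumrB; apply: eq_bigr => e _; rewrite mulrBl.
have -> : \sum_e chi (v + step e) * plane (v + step e) =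
    plane v * \sum_e chi (v + step e) * plane (step e).
  by rewrite mulr_sumr; apply: eq_bigr => e _; rewrite planeD mulrCA.
rewrite sum_plane_step /y.
have -> : (q + 2 * k%:R * (1 - cos t))%:C = q%:C + (2 * k%:R * (1 - cos t))%:C :> R[i].
  by rewrite rmorphD.
have -> : ((n * 2)%:R - 2 * k%:R * (1 - cos t))%:C =
    (n * 2)%:R - (2 * k%:R * (1 - cos t))%:C :> R[i].
  by rewrite rmorphB rmorph_nat.
by ring.
Qed.

Definition box (a : int) (N : nat) : seq Z :=
  [seq \row_s (a + (g s)%:Z) | g : {ffun 'I_k -> 'I_N} ].

Lemma size_box a N : size (box a N) = (N ^ k)%N.
Proof. by rewrite size_map -cardE card_ffun !card_ord. Qed.

Lemma mem_box a N v : (v \in box a N) = [forall s, a <= v 0 s < a + N%:Z].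
Proof.
apply/mapP/forallP => [[g _ ->] s|vbox].
  by rewrite mxE lerDl /= ltrD2l ltz_nat ltn_ord.
have vlt s : (absz (v 0 s - a)%R < N)%N.
  have /andP[lo hi] := vbox s.
  by rewrite -ltz_nat gez0_abs ?subr_ge0// ltrBlDl.
exists [ffun s => Ordinal (vlt s)]; first by rewrite mem_enum.
apply/rowP => s; rewrite mxE ffunE /=.
by have /andP[lo hi] := vbox s; rewrite gez0_abs ?subr_ge0// addrC subrK.
Qed.

Lemma uniq_box a N : uniq (box a N).
Proof.
rewrite map_inj_uniq ?enum_uniq// => g h /rowP gh; apply/ffunP => s.
by have := gh s; rewrite !mxE => /addrI [] /val_inj.
Qed.


Lemma step_bound e s : -1 <= step e 0 s <= 1.
Proof. by rewrite mxE; case: ifP => // _; case: e.2. Qed.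

Lemma coordD v w s : (v + w) 0 s = v 0 s + w 0 s.
Proof. by rewrite mxE. Qed.

Let chi N v : R[i] := (v \in box 0 N.+2)%:R.
(** Outside this layer, a vertex and its neighbours are on the same side of the
boundary of the truncation. *)
Let shell N := [seq v <- box (-1) N.+4 | v \notin box 1 N].

Lemma chi_const N v e : v \notin shell N -> chi N (v + step e) = chi N v.
Proof.
rewrite mem_filter negb_and negbK => vs; rewrite /chi; congr (_%:R); congr nat_of_bool.
rewrite !mem_box; apply/forallP/forallP => h s.
  move: vs; rewrite !mem_box => /orP[/forallP/(_ s)|/forallPn[s' hs']].
    by lia.
  by have := h s'; have := step_bound e s'; rewrite coordD; move: hs'; lia.
move: vs; rewrite !mem_box => /orP[/forallP/(_ s)|/forallPn[s' hs']].
  by have := step_bound e s; rewrite coordD; lia.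
by have := h s'; move: hs'; lia.
Qed.

Lemma size_shell N : (size (shell N) + N ^ k <= N.+4 ^ k)%N.
Proof.
rewrite -(size_box 1 N) -(size_box (-1) N.+4) -size_cat; apply: uniq_leq_size.
  rewrite cat_uniq filter_uniq ?uniq_box// andbT /=.
  by apply/hasPn => v vin; rewrite mem_filter vin.
move=> v; rewrite mem_cat mem_filter => /orP[/andP[_]//|].
by rewrite !mem_box => /forallP h; apply/forallP => s; have := h s; lia.
Qed.

Let packet N v := chi N v * plane v.

Lemma nsq_plane v : nsq (plane v) = 1.
Proof. exact: nsq_cexpi. Qed.

Lemma nsq_packet N v : nsq (packet N v) = (v \in box 0 N.+2)%:R.
Proof.
rewrite nsqM nsq_plane mulr1 /chi.
by case: (v \in _); rewrite /nsq /= ?expr1n ?expr0n ?addr0.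
Qed.

Lemma sum_packet N : \sum_(v <- box 0 N.+2) nsq (packet N v) = (N.+2 ^ k)%:R.
Proof.
rewrite -(size_box 0) -sum1_size natr_sum; apply: eq_big_seq => v vb.
by rewrite nsq_packet vb.
Qed.

Lemma packet_sqsum N : sqsum_le (packet N) (N.+2 ^ k)%:R.
Proof.
move=> s us; rewrite -(size_box 0).
apply: (@le_trans _ _ (size [seq v <- s | v \in box 0 N.+2])%:R); last first.
  rewrite ler_nat; apply: uniq_leq_size; first exact: filter_uniq.
  by move=> v; rewrite mem_filter => /andP[].
under eq_bigr do rewrite nsq_packet.
rewrite -natr_sum ler_nat size_filter -sum1_count [X in (_ <= X)%N]big_mkcond.
by apply: leq_sum => v _; case: (v \in _).
Qed.

Let D : R := (#|{: E}|%:R) ^+ 2.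

Lemma residual_sqsum N : sqsum_le
  (fun v => schrodinger G Q (packet N) v - y%:C * packet N v) (D * (size (shell N))%:R).
Proof.
move=> s us.
have resE v : nsq (schrodinger G Q (packet N) v - y%:C * packet N v) <=
    if v \in shell N then D else 0.
  rewrite truncated_plane nsqM nsq_plane mul1r; case: ifPn => vs; last first.
    by rewrite big1 ?nsq0// => e _; rewrite (chi_const e vs) subrr mul0r.
  apply: nsq_sum_le => e; rewrite nsqM nsq_plane mulr1 /chi.
  by case: (v \in _); case: (_ \in _); rewrite /nsq /=; lra.
apply: (@le_trans _ _ (\sum_(v <- s) if v \in shell N then D else 0)).
  exact: ler_sum.
rewrite -big_mkcond -big_filter big_const_seq count_predT iter_addr_0 -[D *+ _]mulr_natr.
rewrite ler_wpM2l ?sqr_ge0// ler_nat; apply: uniq_leq_size.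
  exact: filter_uniq.
by move=> v; rewrite mem_filter => /andP[].
Qed.

(** A bounded inverse would bound the volume of a box by a multiple of the size of
its boundary layer. *)
Lemma plane_wave_energy_in_sigma : sigma Q y.
Proof.
rewrite /sigma /spectrum /= => -[S [M SM]].
have [N NP] := volume_dominates_boundary k0 (mulr_ge0 (normr_ge0 M) (sqr_ge0 _ : 0 <= D)).
have fl2 : in_l2 (packet N).
  by rewrite /in_l2 (@le_lt_trans _ _ (N.+2 ^ k)%:R%:E) ?ltry//; apply/l2norm_le/packet_sqsum.
pose g v := schrodinger G Q (packet N) v - y%:C * packet N v.
have gle : (l2norm_sq g <= (D * (size (shell N))%:R)%:E)%E.
  by apply/l2norm_le; exact: residual_sqsum.
have gl2 : in_l2 g by rewrite /in_l2 (le_lt_trans gle) ?ltry.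
have [_ _ Sg] := SM _ fl2; have [Sgle _ _] := SM _ gl2.
have [c c0 gE] : exists2 c, 0 <= c & l2norm_sq g = c%:E by exact/in_l2P.
move: Sgle gle; rewrite -/g in Sg; rewrite Sg gE -EFinM lee_fin.
move=> /l2norm_le/(_ _ (uniq_box 0 N.+2)); rewrite sum_packet => h1 h2.
move: NP; apply/negP; rewrite -leNgt; apply: (le_trans h1).
apply: (@le_trans _ _ (`|M| * c)); first by rewrite ler_wpM2r// ler_norm.
rewrite -mulrA ler_wpM2l//; apply: (le_trans h2); rewrite ler_wpM2l ?sqr_ge0//.
by rewrite lerBrDr -natrD ler_nat size_shell.
Qed.

End Bouquet.

Lemma bouquet_segment_in_sigma (R : realType) (k n : nat) (k0 : (0 < k)%N)
    (kn : (k <= n)%N) (Q : vertex (bouquet_cover R k0 kn) -> R) :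
  periodic_potential Q -> exists q : R, `[q, q + 4 * k%:R]%classic `<=` sigma Q.
Proof.
move=> Qper; exists (Q (0 : 'rV[int]_k)) => x /=; rewrite in_itv/=.
set q := Q _ => /andP[qx xq].
have kR : 0 < k%:R :> R by rewrite ltr0n.
pose c := 1 - (x - q) / (2 * k%:R).
have c1 : -1 <= c <= 1.
  have r0 : 0 <= (x - q) / (2 * k%:R).
    by rewrite divr_ge0 ?subr_ge0// mulr_ge0// ltW.
  have r2 : (x - q) / (2 * k%:R) <= 2 by rewrite ler_pdivrMr ?mulr_gt0//; lra.
  by rewrite /c; apply/andP; split; lra.
have -> : x = q + 2 * k%:R * (1 - cos (acos c)).
  by rewrite acosK ?in_itv// /c; field; rewrite gt_eqF.
exact: plane_wave_energy_in_sigma.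
Qed.

Theorem theorem2p4 (R : realType) :
  (forall (d : nat) (G : periodicGraph R d) (Q : vertex G -> R)
      (m : oneForm G),
    periodic_potential Q -> minimal_form m ->
    (forall n : 'I_#|fvertex G|,
       band Q m n `<=`
         `[mu Q m n, mu Q m n + 2 * (kappa_plus m)%:R]%classic) /\
    (lebesgue_measure (sigma Q)
       <= \sum_(n < #|fvertex G|) lebesgue_measure (band Q m n))%E /\
    (\sum_(n < #|fvertex G|) lebesgue_measure (band Q m n)
       <= (4 * calI m)%:E)%E) /\
  (forall k n : nat, (0 < k)%N -> (k <= n)%N ->
    exists (G : periodicGraph R k) (m : oneForm G),
      [/\ minimal_form m,
          calI m = k%:R,
          betti (fund_graph G) = n%:Z &
          forall Q : vertex G -> R, periodic_potential Q ->
            lebesgue_measure (sigma Q)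
              = (\sum_(i < #|fvertex G|) lebesgue_measure (band Q m i))%E /\
            (\sum_(i < #|fvertex G|) lebesgue_measure (band Q m i))%E
              = (4 * calI m)%:E]).
Proof.
split=> [d G Q m Qper [mF _]|k n k0 kn].
  split; first exact: band_subset.
  by split; [exact: measure_spectrum_le | exact: sum_measure_bands_le].
pose G := bouquet_cover R k0 kn; exists G, (kappa G).
have mG : minimal_form (kappa G) by exact: minimal_bouquet.
split=> //; [exact: calI_bouquet | exact: betti_bouquet | move=> Q Qper].
have lower : ((4 * calI (kappa G))%:E <= lebesgue_measure (sigma Q))%E.
  have [q qsub] := bouquet_segment_in_sigma Qper.
  apply: le_trans (lebesgue_measure_mono qsub).
  rewrite lebesgue_measure_segment; last by rewrite lerDl mulr_ge0.
  by rewrite addrAC subrr add0r calI_bouquet.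
have mid := measure_spectrum_le Qper mG.1.
have upper := sum_measure_bands_le Q (kappa G).
split; apply/eqP; rewrite eq_le.
  by rewrite mid (le_trans upper lower).
by rewrite upper (le_trans lower mid).
Qed.
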